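(* Let $q$ be a prime power. If $\mathrm{PGL}_2(q)$ is (isomorphic to) the full automorphism group of an abstract regular polytope $\mathcal P$ of rank $n\ge 4$, then $n=4$, $q=5$, and $\mathcal P$ is the $4$-simplex $\{3,3,3\}$. Equivalently, if $(G,\{\rho_0,\dots,\rho_{n-1}\})$ is a string C-group of rank $n\ge 4$ with $G\cong\mathrm{PGL}_2(q)$, then $n=4$, $q=5$, and $G\cong S_5$ with the generators acting as in the natural representation of $S_5$ as the automorphism group of the $4$-simplex (i.e. $\rho_i$ correspond to the transpositions $(i+1\ i+2)$ up to isomorphism of C-groups).
   Context: An (abstract) polytope of rank $n$ is a ranked partially ordered set with faces of ranks $-1,0,\dots,n$, with a unique least face and a unique greatest face, in which every flag (maximal chain) contains exactly one face of each rank, which is strongly flag-connected, and which is thin: for every flag and every $j=0,\dots,n-1$ there is exactly one other flag differing from it only in the face of rank $j$. It is regular if its automorphism group acts transitively on flags. A string C-group of rank $n$ is a group generated by $n$ pairwise distinct involutions $\rho_0,\dots,\rho_{n-1}$ with $(\rho_j\rho_k)^2=1$ whenever $|j-k|\ge2$ and the intersection property $\langle \rho_j : j\in J\rangle\cap\langle \rho_j : j\in K\rangle=\langle \rho_j : j\in J\cap K\rangle$ for all $J,K\subseteq\{0,\dots,n-1\}$; automorphism groups of regular $n$-polytopes (with generators mapping a base flag to its adjacent flags) are exactly the string C-groups of rank $n$, and each string C-group determines a unique regular polytope. The $4$-simplex has Schläfli type $\{3,3,3\}$ and automorphism group $S_5\cong\mathrm{PGL}_2(5)$. *)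

(* Defs.v *)
From mathcomp Require Import all_boot all_order all_algebra all_fingroup all_solvable.
From mathcomp Require Import boolp classical_sets functions.

Set Implicit Arguments.
Unset Strict Implicit.
Unset Printing Implicit Defensive.

Import Order.TTheory GRing.Theory Num.Theory.
Import Order.SetSubsetOrder.Exports.

Local Open Scope classical_set_scope.
Local Open Scope order_scope.

Section Polytopes.
Variables (disp : Order.disp_t) (P : tbPOrderType disp).

Definition chain (C : set P) : Prop := total_on C (fun x y => x <= y).

(* Flags are the maximal chains. *)
Definition flag (C : set P) : Prop :=
  chain C /\ forall D : set P, chain D -> C `<=` D -> D = C.

(* C and D are distinct and agree outside rank j.  For flags that meet every
   rank exactly once this says that they differ only in the face of rank j. *)
Definition adjacent (rk : P -> int) (j : nat) (C D : set P) : Prop :=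
  C <> D /\ forall x, rk x <> Posz j -> (C x <-> D x).

(* Phi and Psi are joined by successively adjacent flags, all of which contain
   the intersection of Phi and Psi. *)
Definition flag_joined (n : nat) (rk : P -> int) (Phi Psi : set P) : Prop :=
  exists (k : nat) (c : nat -> set P),
    [/\ c 0%N = Phi, c k = Psi,
        forall i, (i <= k)%N -> flag (c i) /\ Phi `&` Psi `<=` c i
      & forall i, (i < k)%N ->
          exists2 j, (j < n)%N & adjacent rk j (c i) (c i.+1)].

(* The unique least and greatest faces are part of tbPOrderType.  The faces
   need not be finite in number. *)
Record abstract_polytope (n : nat) (rk : P -> int) : Prop := AbstractPolytope {
  rank_lt : forall x y, x < y -> (rk x < rk y)%R;
  rank_bounds : forall x, (-1 <= rk x <= Posz n)%R;
  flag_rank : forall Phi, flag Phi ->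
    forall r : int, (-1 <= r <= Posz n)%R -> exists! x, Phi x /\ rk x = r;
  strongly_flag_connected : forall Phi Psi,
    flag Phi -> flag Psi -> flag_joined n rk Phi Psi;
  thin : forall Phi, flag Phi -> forall j, (j < n)%N ->
    exists! Psi, flag Psi /\ adjacent rk j Phi Psi
}.

Definition automorphism (f : P -> P) : Prop :=
  bijective f /\ {mono f : x y / x <= y}.

Definition regular : Prop :=
  forall Phi Psi, flag Phi -> flag Psi ->
    exists2 f, automorphism f & f @` Phi = Psi.

(* The group of all automorphisms of P, under composition, is isomorphic
   to G. *)
Definition aut_group_isog (gT : finGroupType) (G : {group gT}) : Prop :=
  exists phi : gT -> P -> P,
    set_bij [set` G] [set f | automorphism f] phi
    /\ {in G &, forall g h, phi (g * h)%g = phi g \o phi h}.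

End Polytopes.

Definition order_isomorphic (d d' : Order.disp_t)
    (P : porderType d) (Q : porderType d') : Prop :=
  exists f : P -> Q, bijective f /\ {mono f : x y / x <= y}.

(* The face poset of the d-simplex: all sets of vertices ordered by inclusion,
   a face with m vertices having rank m - 1. *)
Definition simplex (d : nat) :
    tbPOrderType Order.SetSubsetOrder.subset_display :=
  Order.SetSubsetOrder.type Order.SetSubsetOrder.subset_display 'I_d.+1.

Record string_C_group (gT : finGroupType) (n : nat) (G : {group gT})
    (rho : 'I_n -> gT) : Prop := StringCGroup {
  sC_gen : <<rho @: 'I_n>>%g = G;
  sC_inj : injective rho;
  sC_involution : forall i, #[rho i]%g = 2%N;
  sC_string : forall j k : 'I_n, (j.+2 <= k)%N || (k.+2 <= j)%N ->
    ((rho j * rho k) ^+ 2 = 1)%g;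
  sC_intersection : forall J K : {set 'I_n},
    (<<rho @: J>> :&: <<rho @: K>> = <<rho @: (J :&: K)>>)%g
}.

Definition PGL2 (F : finFieldType) : {group coset_of 'Z('GL_2[F])%g} :=
  ('GL_2[F] / 'Z('GL_2[F]))%G.

(* Main.v *)
Require Import Defs.
From mathcomp Require Import all_boot all_order all_algebra all_fingroup all_solvable.
From mathcomp Require Import all_field.
From mathcomp Require Import zify ring.
From mathcomp Require boolp classical_sets functions.

(* For q odd, involutions of PGL_2(q) are the nonsingular points of the projective
   plane of trace zero matrices, and distinct ones commute iff they are orthogonal;
   hence a string of involutions has length at most 4.  Let r_0, ..., r_3 be such a
   string generating PGL_2(q), with r_0 and r_1 outside PSL_2(q), and H the group of
   r_0, r_1, r_2.  Elements outside PSL_2(q) have even order, so H contains the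
   involution on their axis; counting H by tori, where the axis of r_0 r_1 is that of
   r_3, not in H, forces r_0 r_1 to have order 3 and the elements of H outside
   PSL_2(q) to have order dividing 4.  The same for r_1, r_2, r_3 makes all angles
   between the four vectors explicit, and their Gram determinant vanishes only in
   characteristic 5 with all r_i r_(i+1) of order 3.  So PGL_2(q) is a quotient of S_5,
   and q = 5 by orders.  In characteristic 2 commuting involutions have commuting
   lifts, and the string would generate an abelian group. *)

Set Implicit Arguments.
Unset Strict Implicit.
Unset Printing Implicit Defensive.
Import Order.TTheory GRing.Theory.

(** * Counting elements of nontrivial sign by tori *)

(** The obstacle is to control [H] without a classification of the subgroups of PGL_2(q). Elements
    of [H] inside PSL_2(q) may be unipotent, or have odd order and an axis outside [H], so counting
    all of [H] by tori gives only an inequality; the half outside PSL_2(q) is counted exactly.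
    Together they yield 1/k + 1/l + 1/m > 1, as for finite rotation groups, with k and l even and m
    odd: this is the origin of the orders 3 and 4, the case k = l = 2 being excluded by noncommuting
    generators. For polytopes the same argument applies to the automorphisms taking a base flag to
    its neighbours. The face order is then recovered from the stabilisers of the base faces, which
    are generated by the generators they contain and correspond to the stabilisers of vertex sets in
    S_5. *)

Lemma two_halves (P : bool) h x z a d : h = 2 * x -> h = x + a -> a = z + d ->
  0 < z -> (if P then h = z else h = 2 * z) -> h = 2 * z /\ d = 0.
Proof. case: P; lia. Qed.

(** Dividing by h/2 turns the last hypothesis into 1/k + 1/l + 1/m > 1. Apart from k = l = 2 this
    leaves only 2, 4 and 3, since 1/2 + 1/6 + 1/3 = 1, while 1/2 + 1/4 + 1/5 and 1/4 + 1/4 + 1/3 are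
    below 1. *)
Lemma torus_count_bound h a b c k l m :
  h = 2 * (a * k) -> h = 2 * (b * l) -> h = 2 * (c * m) -> 0 < h ->
  2 %| k -> 2 %| l -> odd m -> 1 < m ->
  1 + c * m <= a + b + c ->
  k = 2 /\ l = 2 \/ m = 3 /\ (k %| 4) && (l %| 4).
Proof.
move=> hk hl hm h0 k2 l2 mo m1 ineq.
(* A lower bound on a torus order becomes a linear upper bound on the class size, so that the
   problem is linear once [c * m] is a variable. *)
have big t u n : h = 2 * (t * u) -> n <= u -> 2 * n * t <= h.
  by move=> -> nu; rewrite -mulnA leq_mul2l mulnC leq_mul2l nu orbT.
have km := big _ _ _ hk; have lm := big _ _ _ hl; have mm := big _ _ _ hm.
have k0 : 0 < k by move: h0; rewrite hk !muln_gt0 => /and3P[].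
have l0 : 0 < l by move: h0; rewrite hl !muln_gt0 => /and3P[].
have := mm 3; have := mm 4; have := km 2; have := lm 2; have := km 4.
have := lm 4; have := km 6; have := lm 6.
clear - h0 hm k0 l0 k2 l2 mo m1 ineq.
move: (c * m) hm ineq => cm hm ineq *.
have [ck|[ck|ck]] : k = 2 \/ k = 4 \/ 6 <= k by clear - k0 k2; lia.
all: have [cl|[cl|cl]] : l = 2 \/ l = 4 \/ 6 <= l by clear - l0 l2; lia.
all: try (by left).
all: clear k0 l0 k2 l2; try (right; rewrite ck cl; split=> //; lia).
all: exfalso; lia.
Qed.

Section Tori.
Local Open Scope group_scope.

(* In PGL_2, L x y says that matrix lifts of x and y commute; apart from 1, its
   classes are the nontrivial elements of the tori and of the Sylow subgroups in the
   defining characteristic. *)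
Record torus_rel (gT : finGroupType) (L : rel gT) (sgn : gT -> bool) : Prop :=
  TorusRel {
  torus_refl : reflexive L;
  torus_sym : symmetric L;
  torus_one : forall x, L x 1;
  torus_mul : forall x y z, L x y -> L x z -> L x (y * z);
  torus_conj : forall x y z, L (x ^ z) (y ^ z) = L x y;
  torus_trans : forall y x z, y != 1 -> L x y -> L y z -> L x z;
  torus_commute : forall x y, L x y -> commute x y;
  torus_invol : forall u v, #[u] = 2 -> #[v] = 2 -> L u v -> u = v;
  torus_anti : forall u x y, #[u] = 2 -> commute x u -> commute y u ->
    ~~ L u x -> ~~ L u y -> L u (x * y);
  torus_sgn : forall x y, sgn (x * y) = sgn x (+) sgn y
}.

Variables (gT : finGroupType) (L : rel gT) (sgn : gT -> bool).
Hypothesis tL : torus_rel L sgn.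

Implicit Types (x y u v s : gT) (H : {group gT}).

Let Lsym := torus_sym tL.
Let sgnM := torus_sgn tL.
Let Lone := torus_one tL.
Let Lmul := torus_mul tL.
Let Lanti := torus_anti tL.
Let Lrefl := torus_refl tL.

Lemma order2P x : reflect (x != 1 /\ x * x = 1) (#[x] == 2).
Proof.
apply: (iffP eqP) => [o2|[x1 xx]].
  split; first by rewrite -order_eq1 o2.
  by have := expg_order x; rewrite o2 expgS expg1.
have: (#[x] %| 2)%N by rewrite order_dvdn expgS expg1 xx.
by move/(prime_nt_dvdP _) => <-; rewrite ?order_eq1.
Qed.

Lemma sgn1 : sgn 1 = false.
Proof. by have := sgnM 1 1; rewrite mulg1 addbb. Qed.

Lemma sgnX x n : sgn (x ^+ n) = odd n && sgn x.
Proof.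
by elim: n => [|n IH]; rewrite ?expg0 ?sgn1 // expgS sgnM IH /=; case: odd; case: sgn.
Qed.

Definition torus u := [set x | L u x].

Fact torus_group_set u : group_set (torus u).
Proof.
apply/group_setP; split=> [|x y]; rewrite !inE; first exact: Lone.
exact: Lmul.
Qed.
Canonical torus_group u := group (torus_group_set u).

Lemma torusXr u x n : L u x -> L u (x ^+ n).
Proof.
move=> Lux; elim: n => [|n IH]; first exact: (torus_one tL).
by rewrite expgS; apply: (torus_mul tL).
Qed.

Lemma torus_uniq x u v :
  x != 1 -> #[u] = 2 -> #[v] = 2 -> L u x -> L v x -> u = v.
Proof.
move=> x1 u2 v2 Lux Lvx; apply: (torus_invol tL) => //.
by apply: (torus_trans tL x1) => //; rewrite Lsym.
Qed.

(** Two distinct points of the plane have only one common orthogonal point: [x * y] lies in the tori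
    of both [a] and [b], and if it were not 1, these tori would coincide. *)
Lemma pole_uniq a b x y :
    #[a] = 2 -> #[b] = 2 -> a <> b -> #[x] = 2 -> #[y] = 2 ->
    commute x a -> commute x b -> commute y a -> commute y b ->
    x <> a -> x <> b -> y <> a -> y <> b -> x = y.
Proof.
move=> a2 b2 ab x2 y2 xa xb ya yb nxa nxb nya nyb.
have nL u z : #[u] = 2 -> #[z] = 2 -> z <> u -> ~~ L u z.
  by move=> u2 z2 zu; apply/negP=> /(torus_invol tL u2 z2) e; case: zu.
have La : L a (x * y) by apply: Lanti => //; apply: nL.
have Lb : L b (x * y) by apply: Lanti => //; apply: nL.
have [xy1|xy1] := eqVneq (x * y) 1; last by case: ab; apply: torus_uniq La Lb.
have /eqP/order2P[_ yy] := y2.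
by rewrite -[x]mulg1 -yy mulgA xy1 mul1g.
Qed.

(** The involution among the powers of [x], standing for its axis; meaningful for even order, in
    particular when [sgn x] holds. *)
Definition pole x := x ^+ #[x]./2.

Lemma sgn_even x : sgn x -> ~~ odd #[x].
Proof. by move=> sx; have := sgn1; rewrite -(expg_order x) sgnX sx andbT => ->. Qed.

Lemma order_pole x : sgn x -> #[pole x] = 2.
Proof.
move/sgn_even => ev; have e: #[x] = (#[x]./2 * 2)%N.
  by rewrite muln2 -{1}(odd_double_half #[x]) (negPf ev).
rewrite /pole orderXdiv; last by rewrite {2}e dvdn_mulr.
rewrite {1}e mulKn //.
by move: (order_gt0 x); rewrite e; case: (_./2).
Qed.

Lemma torus_pole x : L (pole x) x.
Proof. by rewrite Lsym torusXr // Lrefl. Qed.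

Lemma pole_torus u x : #[u] = 2 -> sgn x -> (pole x == u) = L u x.
Proof.
move=> u2 sx; apply/eqP/idP=> [<-|Lux]; first exact: torus_pole.
apply: (@torus_uniq x) => //; last exact: torus_pole.
  by apply: contraTneq sx => ->; rewrite sgn1.
exact: order_pole.
Qed.

Lemma card_sgn H g : g \in H -> sgn g -> (2 * #|[set x in H | sgn x]| = #|H|)%N.
Proof.
move=> gH sg; rewrite -(cardsID [set x | sgn x] H) mul2n -addnn.
have -> : H :&: [set x | sgn x] = [set x in H | sgn x] by apply/setP=> x; rewrite !inE.
congr addn; rewrite -(card_rcoset [set x in H | sgn x] g).
apply: eq_card => x; rewrite mem_rcoset !inE sgnM groupMr ?groupV //.
have -> : sgn g^-1 = true by have := sgnM g^-1 g; rewrite mulVg sgn1 sg; case: sgn.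
by rewrite addbT andbC.
Qed.

(** By [pole_torus] these are exactly the poles of the elements of [H] of nontrivial sign. *)
Definition odd_poles H :=
  [set u in H | (#[u] == 2) && [exists x in H, L u x && sgn x]].

Lemma pole_odd_poles H x : x \in H -> sgn x -> pole x \in odd_poles H.
Proof.
move=> xH sx; rewrite inE groupX // order_pole //=.
by apply/existsP; exists x; rewrite xH torus_pole.
Qed.

(* The elements of H with nontrivial sign are partitioned by their poles. *)
Lemma sum_odd_poles H g : g \in H -> sgn g ->
  (\sum_(u in odd_poles H) #|H :&: torus u| = #|H|)%N.
Proof.
move=> gH sg; rewrite -(card_sgn gH sg) -[in RHS]sum1_card; symmetry; rewrite big_distrr /=.
rewrite (partition_big pole (fun u => u \in odd_poles H)) => [|x]; last first.
  by rewrite inE => /andP[]; apply: pole_odd_poles.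
apply: eq_bigr => u; rewrite inE => /and3P[uH /eqP u2 /existsP[x /and3P[xH Lux sx]]].
(* The sign is nontrivial on this torus because of [x], so half of the torus has nontrivial sign. *)
rewrite -(@card_sgn [group of H :&: torus u] x) //; last by rewrite !inE xH.
rewrite -big_distrr /= sum1_card; congr (2 * _)%N; apply: eq_card => y.
rewrite !inE unfold_in /= inE -andbA [in RHS]andbAC -andbA; congr (_ && _).
by case sy: (sgn y); rewrite //= pole_torus.
Qed.

(** Tori at distinct involutions meet only in 1. *)
Lemma sum_torus_le H (A : {set gT}) : {in A, forall u, #[u] = 2} ->
  (1 + \sum_(u in A) #|(H :&: torus u)^#| <= #|H|)%N.
Proof.
move=> A2; rewrite (cardsD1 1 H) group1 leq_add2l.
under eq_bigr do rewrite -sum1_card.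
rewrite (exchange_big_dep (mem (H^#))) /=; last first.
  by move=> u x _; rewrite !inE => /and3P[-> ->].
rewrite -sum1_card; apply: leq_sum => x; rewrite !inE => /andP[x1 xH].
rewrite sum1_card; apply/card_le1_eqP => u v.
case/andP=> uA; rewrite !inE => /and3P[_ _ Lu].
case/andP=> vA; rewrite !inE => /and3P[_ _ Lv].
by apply/esym; apply: (torus_uniq x1) => //; apply: A2.
Qed.

Lemma card_torusJ H u h : h \in H -> #|H :&: torus (u ^ h)| = #|H :&: torus u|.
Proof.
move=> hH; rewrite -(cardJg (H :&: torus u) h) conjIg conjGid //.
apply: eq_card => x; rewrite !inE; congr (_ && _).
by rewrite mem_conjg inE -[RHS](torus_conj tL _ _ h) conjgKV.
Qed.

Lemma cent1_torus u x : L u x -> x \in 'C[u].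
Proof. by move=> Lux; apply/cent1P/(torus_commute tL); rewrite Lsym. Qed.

(** The centraliser of [u] in [H] contains [H :&: torus u] with index 1 or 2, since by [torus_anti]
    two elements outside the torus have their product inside. *)
Lemma card_class_torus H u : #[u] = 2 ->
  if 'C_H[u] \subset torus u then #|H| = (#|u ^: H| * #|H :&: torus u|)%N
  else #|H| = (2 * (#|u ^: H| * #|H :&: torus u|))%N.
Proof.
move=> u2; have hE : #|H| = (#|u ^: H| * #|'C_H[u]|)%N.
  by rewrite -index_cent1 mulnC Lagrange // subsetIl.
have sub : H :&: torus u \subset 'C_H[u].
  by apply/subsetP=> x; rewrite 3!inE => /andP[-> /cent1_torus].
have [s|/subsetPn[y yC nLy]] := ifPn.
  rewrite hE; congr (_ * _)%N; apply: eq_card => x.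
  apply/idP/idP => [xC|/(subsetP sub)//].
  by rewrite inE (subsetP s x xC); case/setIP: xC => ->.
rewrite hE mulnCA; congr (_ * _)%N.
have -> : (2 * #|H :&: torus u| = #|H :&: torus u| + #|(H :&: torus u) :* y|)%N.
  by rewrite card_rcoset mul2n addnn.
rewrite -(cardsID (torus u) 'C_H[u]); congr addn; apply: eq_card => x.
  apply/idP/idP => [|xC]; first by case/setIP=> /setIP[xH _] xT; rewrite inE xH.
  by rewrite inE (subsetP sub x xC); case/setIP: xC.
case/setIP: yC => yH /cent1P uy; rewrite inE in nLy.
rewrite mem_rcoset; apply/setDP/setIP => [[/setIP[xH /cent1P ux]]|[xyH]]; rewrite inE => Lx.
  rewrite groupM ?groupV // inE Lanti //; first exact/commute_sym/commuteV.
  by apply: contra nLy => /(torusXr #[y^-1].-1); rewrite -invg_expg invgK.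
have xC : x \in 'C_H[u].
  rewrite -[x](mulgKV y) inE groupM //= groupM //; first exact: cent1_torus.
  exact/cent1P.
split=> //; apply: contra nLy; rewrite inE => Lux.
have := Lmul (torusXr #[x * y^-1].-1 Lx) Lux.
by rewrite -invg_expg invMg invgK mulgKV.
Qed.

(* Count H by the tori through its elements.  Half of each torus at an odd pole has
   nontrivial sign, and these halves partition half of H; the class of u accounts for
   half of that, so there is exactly one other class of odd poles, that of some v.
   With s outside H, the tori of the class of s have to fit into what remains, giving
   1/c_u + 1/c_v + 1/c_s > 1 for the orders of these tori. *)
Theorem sgn_torus_orders H s r b u y :
    #[s] = 2 -> s \notin H -> r \in H -> ~~ L s r -> commute r s ->
    b \in H -> b != 1 -> L s b ->
    u \in H -> #[u] = 2 -> sgn u -> y \in H -> commute y u -> ~~ L u y ->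
  {in H, forall g, sgn g -> g ^+ 2 = 1} \/
  #|H :&: torus s| = 3 /\ {in H, forall g, sgn g -> g ^+ 4 = 1}.
Proof.
move=> s2 sH rH nLr rs bH b1 Lb uH u2 su yH yu nLy.
set N := odd_poles H; pose c v := #|H :&: torus v|.
have Nsum : (\sum_(v in N) c v = #|H|)%N by apply: sum_odd_poles su.
have N2 v : v \in N -> #[v] = 2 by rewrite inE => /and3P[_ /eqP].
have NH v : v \in N -> v \in H by rewrite inE => /andP[].
have cJ v w : w \in v ^: H -> c w = c v.
  by case/imsetP=> h hH ->; apply: card_torusJ.
have NJ v w : v \in N -> w \in v ^: H -> w \in N.
  move=> vN /imsetP[h hH ->{w}]; move: vN; rewrite !inE orderJ groupJr //.
  case/and3P=> -> -> /existsP[x /and3P[xH Lx sx]]; apply/existsP; exists (x ^ h).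
  by rewrite groupJr // xH (torus_conj tL) Lx !sgnM sx addbCA -sgnM mulVg sgn1.
have c_even v : v \in N -> (2 %| c v)%N.
  move=> vN; rewrite -(N2 v vN) order_dvdG //.
  by rewrite !inE NH ?Lrefl.
have c_exp v g : v \in N -> g \in H -> L v g -> g ^+ c v = 1.
  by move=> vN gH Lg; rewrite expg_cardG // !inE gH.
have c_gt0 v : (0 < c v)%N by apply: cardG_gt0.
have uN : u \in N by rewrite inE uH u2 eqxx; apply/existsP; exists u; rewrite uH Lrefl.
(* [y] centralises [u] outside its torus, so the index is 2; [r] does the same for [s] below. *)
have uC : #|H| = (2 * (#|u ^: H| * c u))%N.
  have yC : y \in 'C_H[u] by rewrite inE yH; apply/cent1P.
  have := card_class_torus H u2; case: ifPn => // /subsetP /(_ y yC).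
  by rewrite inE (negPf nLy).
have sC : #|H| = (2 * (#|s ^: H| * c s))%N.
  have rC : r \in 'C_H[s] by rewrite inE rH; apply/cent1P.
  have := card_class_torus H s2; case: ifPn => // /subsetP /(_ r rC).
  by rewrite inE (negPf nLr).
have cls v : (\sum_(w in v ^: H) c w = #|v ^: H| * c v)%N.
  by rewrite -sum_nat_const; apply: eq_bigr => w /cJ.
(* An even order would give an involution in the torus of [s], hence [s] itself, inside [H]. *)
have s_odd : odd (c s).
  rewrite -[odd _]negbK -dvdn2; apply: contra sH => /(Cauchy _)[]// w.
  by rewrite !inE => /andP[wH Lw] w2; rewrite (torus_invol tL s2 w2 Lw).
have s_gt1 : (1 < c s)%N.
  have bs : b \in H :&: torus s by rewrite !inE bH.
  by rewrite cardG_gt1; apply: contraNneq b1 => e; rewrite e inE in bs.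
have split_N v : v \in N -> (\sum_(w in N) c w =
    #|v ^: H| * c v + \sum_(w in N :\: v ^: H) c w)%N.
  move=> vN; rewrite (big_setID (v ^: H)) /= -cls; congr addn.
  by apply: eq_bigl => w; rewrite inE; apply: andb_idl; apply: NJ.
have gt0 : (0 < #|u ^: H| * c u)%N by move: (cardG_gt0 H); rewrite uC muln_gt0.
have [v vR] : exists v, v \in N :\: u ^: H.
  apply/set0Pn/eqP => e; move: (split_N u uN) gt0.
  by rewrite e big_set0 Nsum uC mul2n -addnn => /addnI->.
have [vN nvu] := setDP vR.
have vRJ w : w \in v ^: H -> w \in N :\: u ^: H.
  move=> wv; rewrite inE (NJ v) // andbT; apply: contra nvu.
  by move/class_eqP<-; rewrite (class_eqP wv) class_refl.
have split_R : (\sum_(w in N :\: u ^: H) c w =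
    #|v ^: H| * c v + \sum_(w in N :\: u ^: H :\: v ^: H) c w)%N.
  rewrite (big_setID (v ^: H)) /= -cls; congr addn.
  by apply: eq_bigl => w; rewrite inE; apply: andb_idl; apply: vRJ.
have vgt0 : (0 < #|v ^: H| * c v)%N.
  by rewrite muln_gt0 c_gt0 andbT; apply/card_gt0P; exists v; apply: class_refl.
(* The class of [v] contributes all of [#|H|] or half of it; only half is left, so it takes exactly
   that and nothing remains. *)
have [vC R0] : #|H| = (2 * (#|v ^: H| * c v))%N /\
    (\sum_(w in N :\: u ^: H :\: v ^: H) c w = 0)%N.
  apply: (two_halves uC _ split_R vgt0 (card_class_torus H (N2 v vN))).
  by rewrite -Nsum; apply: split_N.
have NE w : w \in N -> w \in u ^: H \/ w \in v ^: H.
  move=> wN; apply/orP; apply: contraTT isT; rewrite negb_or => /andP[nu nv].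
  have: (0 < \sum_(w in N :\: u ^: H :\: v ^: H) c w)%N.
    by rewrite (bigD1 w) /= ?addn_gt0 ?c_gt0 // inE nv inE nu.
  by rewrite R0.
have cardN : #|N| = (#|u ^: H| + #|v ^: H|)%N.
  rewrite -(cardsID (u ^: H) N); congr addn; apply: eq_card => w.
    by rewrite inE; apply: andb_idl; apply: NJ.
  apply/idP/idP => [/setDP[wN nw]|/vRJ//]; by case: (NE w wN) => // wu; rewrite wu in nw.
have dNs : [disjoint N & s ^: H].
  apply/pred0P => w /=; apply/negP => /andP[/NH wH /imsetP[h hH e]].
  by move: sH; rewrite -(groupJr _ hH) -e wH.
have A2 : {in N :|: s ^: H, forall w, #[w] = 2}.
  by move=> w /setUP[/N2//|/imsetP[h _ ->]]; rewrite orderJ.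
have sumA (A : {set gT}) : (\sum_(w in A) #|(H :&: torus w)^#| + #|A| = \sum_(w in A) c w)%N.
  rewrite -sum1_card -big_split /=; apply: eq_bigr => w _.
  by rewrite /c (cardsD1 1 (_ :&: _)) group1 addnC.
(* The tori over [N] already sum to [#|H|], but with the identity counted [#|N|] times; only these
   repetitions leave room for the tori of the class of [s]. *)
have ineq : (1 + #|s ^: H| * c s <= #|u ^: H| + #|v ^: H| + #|s ^: H|)%N.
  have := sum_torus_le H A2.
  rewrite (eq_bigl [predU N & s ^: H]) => [|w]; last by rewrite inE.
  move: (sumA N) (sumA (s ^: H)); rewrite bigU //= Nsum cardN cls.
  move: (\sum_(i in N) #|(H :&: torus i)^#|)%N (\sum_(i in s ^: H) #|(H :&: torus i)^#|)%N.
  move: #|H| #|u ^: H| #|v ^: H| #|s ^: H| (_ * _)%N.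
  by clear => *; lia.
have [e|[cs3 e4]] : (c u = 2 /\ c v = 2 \/ c s = 3 /\ (c u %| 4) && (c v %| 4))%N.
- by apply: torus_count_bound uC vC sC _ _ _ _ _ ineq; rewrite ?c_even ?cardG_gt0.
- left=> g gH sg; have := c_exp (pole g) g (pole_odd_poles gH sg) gH (torus_pole g).
  by case: e => cu cv; case: (NE _ (pole_odd_poles gH sg)) => /cJ->; rewrite ?cu ?cv.
- right; split=> // g gH sg; have := c_exp (pole g) g (pole_odd_poles gH sg) gH (torus_pole g).
  case/andP: e4 => /dvdnP[i ei] /dvdnP[j ej].
  case: (NE _ (pole_odd_poles gH sg)) => /cJ-> e; [rewrite ei | rewrite ej].
    by rewrite mulnC expgM e expg1n.
  by rewrite mulnC expgM e expg1n.
Qed.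

(** * Strings of four independent involutions *)

Record indep_string4 (a b c d : gT) : Prop := IndepString4 {
  is4_a2 : #[a] = 2; is4_b2 : #[b] = 2; is4_c2 : #[c] = 2; is4_d2 : #[d] = 2;
  is4_ac : commute a c; is4_ad : commute a d; is4_bd : commute b d;
  is4_a : a \notin <<[set b; c; d]>>; is4_b : b \notin <<[set a; c; d]>>;
  is4_c : c \notin <<[set a; b; d]>>; is4_d : d \notin <<[set a; b; c]>>
}.

Lemma indep_string4_rev a b c d : indep_string4 a b c d -> indep_string4 d c b a.
Proof.
have set3C x y z : [set x; y; z] = [set z; y; x] by rewrite setUC setUA setUAC.
by case=> ? ? ? ? ? ? ? ? ? ? ?; split; rewrite 1?set3C //; apply: commute_sym.
Qed.

Lemma mem_gen3 (a b c : gT) :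
  [/\ a \in <<[set a; b; c]>>, b \in <<[set a; b; c]>> & c \in <<[set a; b; c]>>].
Proof. by split; apply: mem_gen; rewrite !inE eqxx ?orbT. Qed.

Lemma indep_string4_neq a b c d : indep_string4 a b c d ->
  [/\ a <> b, a <> c, a <> d, b <> c & b <> d /\ c <> d].
Proof.
case=> _ _ _ _ _ _ _ /negP na /negP nb /negP nc _.
have [m1 m2 m3] := mem_gen3 b c d; have [m4 m5 m6] := mem_gen3 a c d.
have [_ _ m7] := mem_gen3 a b d.
by split; [| | | |split] => e; [case: na|case: na|case: na|case: nb|case: nb|case: nc];
   rewrite e.
Qed.

Lemma nL_invol u v : #[u] = 2 -> #[v] = 2 -> u <> v -> ~~ L u v.
Proof. by move=> u2 v2 uv; apply/negP => /(torus_invol tL u2 v2). Qed.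

Lemma mulg_invol u v : #[u] = 2 -> #[v] = 2 -> u <> v -> u * v != 1.
Proof.
move=> u2 /eqP/order2P[_ vv] uv; apply/eqP => e; apply: uv.
by rewrite -[u]mulg1 -vv mulgA e mul1g.
Qed.

Lemma order_commuteM u v : #[u] = 2 -> #[v] = 2 -> commute u v -> u <> v -> #[u * v] = 2.
Proof.
move=> u2 v2 uv nuv; apply/eqP/order2P; split; first exact: mulg_invol.
have /eqP/order2P[_ uu] := u2; have /eqP/order2P[_ vv] := v2.
by rewrite {1}uv mulgA -[v * u * u]mulgA uu mulg1.
Qed.

Lemma sqr_commute u v : #[u] = 2 -> #[v] = 2 -> (u * v) ^+ 2 = 1 -> commute u v.
Proof.
move=> u2 v2 /eqP; rewrite expgS expg1 -eq_invg_mul invMg !invg2id // => /eqP e.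
exact: esym.
Qed.

(** Both [a] and [b] commute with [d] from outside its torus, so [a * b] lies in it. Were its sign
    nontrivial, its pole would be [d], making [d] a power of [a * b] against independence. *)
Lemma sgn_facet a b c d : indep_string4 a b c d -> sgn b = sgn a.
Proof.
move=> I4; have [a2 b2 c2 d2 ac ad bd na nb nc nd] := I4.
have [ab' ac' ad' bc' [bd' cd']] := indep_string4_neq I4.
have Lab : L d (a * b) by apply: Lanti; rewrite ?nL_invol //; apply: nesym.
have [aH bH cH] := mem_gen3 a b c.
have := sgnM a b; case sab: (sgn (a * b)); last by case: sgn; case: sgn.
case/negP: nd; have /eqP <- : pole (a * b) == d by rewrite pole_torus.
by rewrite groupX // groupM.
Qed.

(** The torus count with [d] as the involution outside: it commutes with [a], and its torus contains
    [a * b]. Whichever of [a] and [c] has nontrivial sign serves as [u], and the other as [y]. *)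
Lemma facet_orders a b c d : indep_string4 a b c d -> sgn a || sgn c ->
  {in <<[set a; b; c]>>, forall g, sgn g -> g ^+ 2 = 1} \/
  (a * b) ^+ 3 = 1 /\ {in <<[set a; b; c]>>, forall g, sgn g -> g ^+ 4 = 1}.
Proof.
move=> I4 sac; have [a2 b2 c2 d2 ac ad bd na nb nc nd] := I4.
have [ab' ac' ad' bc' [bd' cd']] := indep_string4_neq I4.
have [aH bH cH] := mem_gen3 a b c.
have nL u v := @nL_invol u v.
have Lab : L d (a * b) by apply: Lanti; rewrite ?nL //; apply: nesym.
have abH : a * b \in <<[set a; b; c]>> by rewrite groupM.
have nda := nL _ _ d2 a2 (nesym ad').
have main u y : u \in <<[set a; b; c]>> -> #[u] = 2 -> sgn u ->
    y \in <<[set a; b; c]>> -> commute y u -> ~~ L u y -> 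
  {in <<[set a; b; c]>>, forall g, sgn g -> g ^+ 2 = 1} \/
  (a * b) ^+ 3 = 1 /\ {in <<[set a; b; c]>>, forall g, sgn g -> g ^+ 4 = 1}.
  move=> uH u2 su yH yu nLy.
  have := sgn_torus_orders d2 nd aH nda ad abH (mulg_invol a2 b2 ab') Lab uH u2 su yH yu nLy.
  case=> [|[e3 ?]]; [by left | right; split=> //].
  by rewrite -[3]e3 expg_cardG // !inE abH.
by case/orP: sac => [sa|sc]; [apply: (main a c)|apply: (main c a)];
  rewrite ?nL //; apply: nesym.
Qed.

(** Otherwise [a] and [b] would both be the one involution orthogonal to [c] and [d]. *)
Lemma bc_not_commute a b c d : indep_string4 a b c d -> ~ commute b c.
Proof.
move=> I4 bc; have [a2 b2 c2 d2 ac ad bd na nb nc nd] := I4.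
have [ab' ac' ad' bc' [bd' cd']] := indep_string4_neq I4.
by apply: ab'; apply: (@pole_uniq c d).
Qed.

(** Otherwise [a * c] and [d] would both be the one involution orthogonal to [a] and [b], and [d]
    would lie in the group of [a], [b], [c]. *)
Lemma b_ac_not_commute a b c d : indep_string4 a b c d -> ~ commute (a * c) b.
Proof.
move=> I4 bc; have [a2 b2 c2 d2 ac ad bd na nb nc nd] := I4.
have [ab' ac' ad' bc' [bd' cd']] := indep_string4_neq I4.
have [aH bH cH] := mem_gen3 a b c; have [aK cK dK] := mem_gen3 a c d.
case/negP: nd; rewrite -(@pole_uniq a b (a * c) d) ?groupM //.
- exact: order_commuteM.
- exact/commute_sym/commuteM.
- by move/(congr1 (mulg a^-1)); rewrite mulKg mulVg => e; rewrite e order1 in c2.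
- by move=> e; case/negP: nb; rewrite -e groupM.
- exact: nesym.
- exact: nesym.
Qed.

(** Signs agree within [a], [b] and within [c], [d], so exactly one of [b * c] and [a * b * c] has
    nontrivial sign. Noncommutation keeps its square away from 1, which rules out the first
    alternative of [facet_orders]; the reversed string is treated alike. *)
Lemma string4_orders a b c d : indep_string4 a b c d -> sgn a ->
  [/\ (a * b) ^+ 3 = 1, (c * d) ^+ 3 = 1
    & (b * c) ^+ 2 != 1 /\ (b * c) ^+ 4 = 1 \/
      (a * b * c) ^+ 2 != 1 /\ (a * b * c) ^+ 4 = 1].
Proof.
move=> I4 sa; have I4' := indep_string4_rev I4.
have [a2 b2 c2 d2 ac ad bd na nb nc nd] := I4.
have [aH bH cH] := mem_gen3 a b c; have [dK cK bK] := mem_gen3 d c b.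
have sb : sgn b by rewrite (sgn_facet I4).
have sd : sgn d = sgn c by rewrite (sgn_facet I4').
have nbc : (b * c) ^+ 2 != 1.
  by apply/eqP => e; apply: (bc_not_commute I4); apply: sqr_commute.
have nac : (a * b * c) ^+ 2 != 1.
  apply/eqP => e; apply: (b_ac_not_commute I4).
  have ac2 : #[a * c] = 2 by apply: order_commuteM => //; case: (indep_string4_neq I4).
  apply/commute_sym/sqr_commute => //.
  suff <- : (a * b * c) ^ a = b * (a * c) by rewrite -conjXg e conj1g.
  by rewrite /conjg -!mulgA mulKg ac.
have ndb : (d * c * b) ^+ 2 != 1.
  apply/eqP => e; apply: (b_ac_not_commute I4').
  have ac2 : #[d * b] = 2.
    by apply: order_commuteM => //; case: (indep_string4_neq I4').
  apply/commute_sym/sqr_commute => //.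
  suff <- : (d * c * b) ^ d = c * (d * b) by rewrite -conjXg e conj1g.
  by rewrite /conjg -!mulgA mulKg bd.
have dc_cd : (d * c) ^+ 3 = 1 -> (c * d) ^+ 3 = 1.
  move=> e; suff <- : (d * c) ^ d = c * d by rewrite -conjXg e conj1g.
  by rewrite /conjg -!mulgA mulKg.
have fH := facet_orders I4 (introT orP (or_introl sa)).
have := facet_orders I4'; rewrite sb orbT => /(_ isT).
have abcH : a * b * c \in <<[set a; b; c]>> by rewrite !groupM.
have bcH : b * c \in <<[set a; b; c]>> by rewrite !groupM.
have dcbK : d * c * b \in <<[set d; c; b]>> by rewrite !groupM.
have bcK : b * c \in <<[set d; c; b]>> by rewrite !groupM.
case sc: (sgn c).
  have s1 : sgn (a * b * c) by rewrite !sgnM sa sb sc.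
  have s2 : sgn (d * c * b) by rewrite !sgnM sd sb sc.
  case: fH => [/(_ _ abcH s1) e|[ab3 e4]]; first by rewrite e eqxx in nac.
  case=> [/(_ _ dcbK s2) e|[dc3 _]]; first by rewrite e eqxx in ndb.
  by split; [|exact: dc_cd|right; split=> //; apply: e4].
have s1 : sgn (b * c) by rewrite !sgnM sb sc.
case: fH => [/(_ _ bcH s1) e|[ab3 e4]]; first by rewrite e eqxx in nbc.
case=> [/(_ _ bcK s1) e|[dc3 _]]; first by rewrite e eqxx in nbc.
by split; [|exact: dc_cd|left; split=> //; apply: e4].
Qed.

End Tori.

(** * Trace zero matrices and involutions of PGL_2 *)

Section Matrix2.
Local Open Scope ring_scope.
Variable F : fieldType.
Implicit Types A B C D M : 'M[F]_2.

(** Closes an identity modulo one known equation [u = v]: the comparison of differences is left to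
    [ring]. *)
Lemma eq_sub_eq (x y u v : F) : u = v -> x - y = u - v -> x = y.
Proof. by move=> ->; rewrite subrr => /eqP; rewrite subr_eq0 => /eqP. Qed.

Lemma ord2P (P : 'I_2 -> Prop) : P 0 -> P 1 -> forall i, P i.
Proof.
by move=> P0 P1 [[|[|//]] hi];
   [rewrite (_ : Ordinal hi = 0) | rewrite (_ : Ordinal hi = 1)] => //; apply: val_inj.
Qed.

Lemma mx2P A B : A 0 0 = B 0 0 -> A 0 1 = B 0 1 -> A 1 0 = B 1 0 -> A 1 1 = B 1 1 -> A = B.
Proof.
move=> e1 e2 e3 e4; apply/matrixP=> i j.
by elim/ord2P: i; elim/ord2P: j.
Qed.

Lemma mulmx2E A B i j : (A *m B) i j = A i 0 * B 0 j + A i 1 * B 1 j.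
Proof. by rewrite mxE !big_ord_recl big_ord0 addr0; congr (_ + A i _ * B _ j); apply: val_inj. Qed.

Lemma det2E A : \det A = A 0 0 * A 1 1 - A 0 1 * A 1 0.
Proof.
rewrite (expand_det_row _ 0) !big_ord_recl big_ord0 addr0 /cofactor !det_mx11 !mxE /=.
rewrite expr0 mul1r expr1 mulN1r mulrN.
by congr (_ * A _ _ - A _ _ * A _ _); apply: val_inj.
Qed.

Lemma tr2E A : \tr A = A 0 0 + A 1 1.
Proof. by rewrite /mxtrace !big_ord_recl big_ord0 addr0; congr (_ + A _ _); apply: val_inj. Qed.

Lemma scalar2 A : A 0 1 = 0 -> A 1 0 = 0 -> A 0 0 = A 1 1 -> A = (A 0 0)%:M.
Proof. by move=> e1 e2 e3; apply: mx2P; rewrite !mxE. Qed.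

(** Modulo scalars a matrix is the triple of its off-diagonal entries and the difference of its
    diagonal ones; the equations say that the cross product of two triples vanishes. *)
Lemma comm2P A B : reflect
  [/\ A 0 1 * B 1 0 = B 0 1 * A 1 0,
      A 0 1 * (B 0 0 - B 1 1) = B 0 1 * (A 0 0 - A 1 1)
    & A 1 0 * (B 0 0 - B 1 1) = B 1 0 * (A 0 0 - A 1 1)]
  (A *m B == B *m A).
Proof.
apply: (iffP eqP) => [e|[e1 e2 e3]]; last first.
  by apply: mx2P; rewrite !mulmx2E; [apply: (eq_sub_eq e1)|apply: (eq_sub_eq (esym e2))
    |apply: (eq_sub_eq e3)|apply: (eq_sub_eq (esym e1))]; ring.
have E i j := congr1 (fun M : 'M_2 => M i j) e.
have := E 0 0; have := E 0 1; have := E 1 0; rewrite !mulmx2E => e3 e2 e1.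
by split; [apply: (eq_sub_eq e1)|apply: (eq_sub_eq (esym e2))|apply: (eq_sub_eq e3)]; ring.
Qed.

(** The centraliser of a nonscalar matrix consists of the polynomials in it; [k] is read off at a
    nonzero coordinate of [B] modulo scalars. *)
Lemma comm2_span A B : A *m B = B *m A -> B <> (B 0 0)%:M ->
  exists k l, A = k *: B + l%:M.
Proof.
move=> /eqP/comm2P[e1 e2 e3] nB.
have [k [k1 k2 k3]] : exists k, [/\ A 0 1 = k * B 0 1, A 1 0 = k * B 1 0
    & A 0 0 - A 1 1 = k * (B 0 0 - B 1 1)].
  have [b1|b1] := eqVneq (B 0 1) 0; last first.
    exists (A 0 1 / B 0 1); split; apply: (mulfI b1).
    - by field.
    - by rewrite -e1; field.
    - by rewrite -e2; field.
  have [b2|b2] := eqVneq (B 1 0) 0; last first.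
    exists (A 1 0 / B 1 0); split; apply: (mulfI b2).
    - by rewrite mulrC e1; field.
    - by field.
    - by rewrite -e3; field.
  have b3 : B 0 0 - B 1 1 != 0.
    by rewrite subr_eq0; apply: contra_notN nB => /eqP b3; apply: scalar2.
  exists ((A 0 0 - A 1 1) / (B 0 0 - B 1 1)); split; apply: (mulfI b3).
  - by rewrite mulrC e2; field.
  - by rewrite mulrC e3; field.
  - by field.
exists k, (A 0 0 - k * B 0 0); apply: mx2P; rewrite !mxE /= ?mulr1n ?mulr0n ?addr0 //.
  by ring.
by apply: (eq_sub_eq (esym k3)); ring.
Qed.

Lemma comm2_trans B A C : B <> (B 0 0)%:M ->
  A *m B = B *m A -> B *m C = C *m B -> A *m C = C *m A.
Proof.
move=> nB /comm2_span/(_ nB)[k [l ->]] /esym/comm2_span/(_ nB)[k' [l' ->]].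
by apply/eqP/comm2P; rewrite !mxE /= ?mulr1n ?mulr0n; split; ring.
Qed.

(** By Cayley-Hamilton [A *m A] equals [\tr A *: A] up to a scalar matrix. *)
Lemma tr_sqr_scalar A c : A *m A = c%:M -> A <> (A 0 0)%:M -> \tr A = 0.
Proof.
move=> e nA; have E i j : (A *m A) i j = (c%:M : 'M_2) i j by rewrite e.
apply/eqP; apply: contra_notT nA; rewrite tr2E => t0; apply: scalar2.
- have := E 0 1; rewrite mulmx2E !mxE mulr0n => e1; apply: (mulfI t0).
  by rewrite mulr0 -e1; ring.
- have := E 1 0; rewrite mulmx2E !mxE mulr0n => e1; apply: (mulfI t0).
  by rewrite mulr0 -e1; ring.
- have := E 0 0; have := E 1 1; rewrite !mulmx2E !mxE /= => <- e1.
  by apply: (mulfI t0); apply: (eq_sub_eq e1); ring.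
Qed.

Lemma det_tr0 A : \tr A = 0 -> A 1 1 = - A 0 0.
Proof. by rewrite tr2E addrC => /eqP; rewrite addr_eq0 => /eqP. Qed.

(* The Gram determinant of four vectors of the 3-dimensional space of trace zero
   matrices under the trace form, for which \tr (A *m A) = -2 \det A. *)
Lemma gram4_string A B C D :
  \tr A = 0 -> \tr B = 0 -> \tr C = 0 -> \tr D = 0 ->
  \tr (A *m C) = 0 -> \tr (A *m D) = 0 -> \tr (B *m D) = 0 ->
  16 * (\det A * \det B * \det C * \det D)
  + \tr (A *m B) ^+ 2 * \tr (C *m D) ^+ 2
  = 4 * (\det C * \det D * \tr (A *m B) ^+ 2 + \det A * \det D * \tr (B *m C) ^+ 2
         + \det A * \det B * \tr (C *m D) ^+ 2).
Proof.
move=> /det_tr0 tA /det_tr0 tB /det_tr0 tC /det_tr0 tD.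
pose g (X Y : 'M[F]_2) := \tr (X *m Y).
rewrite -/(g A C) -/(g A D) -/(g B D) => AC AD BD.
(* The vanishing of the Gram determinant, with every term that contains one of the three zero
   products moved to the right. *)
have gram : 16 * (\det A * \det B * \det C * \det D) + g A B ^+ 2 * g C D ^+ 2
  - 4 * (\det C * \det D * g A B ^+ 2 + \det A * \det D * g B C ^+ 2
         + \det A * \det B * g C D ^+ 2)
  = - (2 * (-2 * \det A) * g B C * g B D * g C D + 4 * \det A * \det C * - g B D ^+ 2
    + 2 * g A B * g A C * g B C * (-2 * \det D) - 2 * g A B * g A C * g B D * g C D
    - 2 * g A B * g A D * g B C * g C D + 2 * g A B * g A D * g B D * (-2 * \det C)
    - g A C ^+ 2 * (4 * \det B * \det D) + g A C ^+ 2 * g B D ^+ 2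
    + 2 * g A C * g A D * (-2 * \det B) * g C D - 2 * g A C * g A D * g B C * g B D
    - g A D ^+ 2 * (4 * \det B * \det C) + g A D ^+ 2 * g B C ^+ 2).
  by rewrite /g !tr2E !mulmx2E !det2E tA tB tC tD; ring.
apply/eqP; rewrite -subr_eq0 gram AC AD BD; apply/eqP; ring.
Qed.

(** On trace zero matrices [\tr (A *m B *m C)] is an alternating trilinear form; its square is -1/2
    times the Gram determinant of the three vectors. *)
Lemma tr_mul3_sqr A B C : (2 : F) != 0 ->
  \tr A = 0 -> \tr B = 0 -> \tr C = 0 -> \tr (A *m C) = 0 ->
  \tr (A *m B *m C) ^+ 2 = 4 * (\det A * \det B * \det C)
    - \det A * \tr (B *m C) ^+ 2 - \det C * \tr (A *m B) ^+ 2.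
Proof.
move=> two /det_tr0 tA /det_tr0 tB /det_tr0 tC AC; apply: (mulfI two).
apply: (eq_sub_eq (u := - 2 * \tr (A *m B) * \tr (B *m C) * \tr (A *m C)
    - 2 * \det B * \tr (A *m C) ^+ 2) (v := 0)); first by rewrite AC; ring.
by rewrite !tr2E !mulmx2E !det2E tA tB tC; ring.
Qed.

(** By Cayley-Hamilton the cube of [M] is [(\tr M ^+ 2 - \det M) *: M] minus the scalar
    [\tr M * \det M]; the next lemma is the converse. *)
Lemma mul3_scalar M : \tr M ^+ 2 = \det M -> M *m M *m M = (- (\tr M * \det M))%:M.
Proof.
rewrite tr2E det2E => e; have E x : x * _ = x * _ := congr1 (fun t => x * t) e.
apply: mx2P; rewrite !mulmx2E !mxE ?mulr1n ?mulr0n /=.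
- by apply: (eq_sub_eq (E (M 0 0))); ring.
- by apply: (eq_sub_eq (E (M 0 1))); ring.
- by apply: (eq_sub_eq (E (M 1 0))); ring.
- by apply: (eq_sub_eq (E (M 1 1))); ring.
Qed.

Lemma mul3_scalar_tr M c : M *m M *m M = c%:M -> M <> (M 0 0)%:M ->
  \tr M ^+ 2 = \det M.
Proof.
move=> e nM; have E i j : (M *m M *m M) i j = (c%:M : 'M_2) i j by rewrite e.
apply/eqP; apply: contra_notT nM; rewrite -subr_eq0 tr2E det2E => t0; apply: scalar2.
- have := E 0 1; rewrite !mulmx2E !mxE mulr0n => e1; apply: (mulfI t0).
  by rewrite mulr0 -e1; ring.
- have := E 1 0; rewrite !mulmx2E !mxE mulr0n => e1; apply: (mulfI t0).
  by rewrite mulr0 -e1; ring.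
- have := E 0 0; have := E 1 1; rewrite !mulmx2E !mxE /= => <- e1.
  by apply: (mulfI t0); apply: (eq_sub_eq e1); ring.
Qed.

Lemma tr_mul2 M : \tr (M *m M) = \tr M ^+ 2 - 2 * \det M.
Proof. by rewrite !tr2E det2E !mulmx2E; ring. Qed.

End Matrix2.


(** * Lifting elements of PGL_2 to matrices *)

Section PGL.
Local Open Scope group_scope.
Local Open Scope ring_scope.
Variable F : finFieldType.

Notation Z := 'Z('GL_2[F])%g.
Notation PGL := (coset_of Z).
Implicit Types (x y z u v : PGL) (A B : 'M[F]_2).

(** An arbitrary representative, so products are lifted only up to a nonzero factor, and what is
    used of a lift must be insensitive to such factors. *)
Definition lift x : 'M[F]_2 := GLval (repr x).

Lemma lift_det x : \det (lift x) != 0.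
Proof. exact: (GL_det (repr x)). Qed.

Lemma GL_normZ (g : {'GL_2[F]}) : g \in 'N(Z)%g.
Proof. by rewrite (subsetP (normal_norm (center_normal _))) // inE. Qed.

Lemma GL_centerP (g : {'GL_2[F]}) : reflect (exists c, GLval g = c%:M) (g \in Z).
Proof.
apply: (iffP idP) => [/centerP[_ gC]|[c gc]]; last first.
  apply/centerP; split=> [|h _]; first by rewrite inE.
  have e : GLval g *m GLval h = GLval h *m GLval g by rewrite gc scalar_mxC.
  exact: val_inj.
have gA A : \det A != 0 -> GLval g *m A = A *m GLval g.
  move=> dA; have Au : (A : 'M_2.-1.+1) \is a GRing.unit.
    by rewrite -[_ \is a _]/(_ \in unitmx) unitmxE unitfE.
  exact: (congr1 (fun h => GLval h) (gC (FinRing.Unit Au) (in_setT _))).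
(* Upper and lower triangular matrices with all remaining entries 1; only scalar matrices commute
   with both. *)
have d1 : \det (\matrix_(i < 2, j < 2) (i <= j)%N%:R : 'M[F]_2) != 0.
  by rewrite det2E !mxE /= mulr0 subr0 mulr1 oner_eq0.
have d2 : \det (\matrix_(i < 2, j < 2) (j <= i)%N%:R : 'M[F]_2) != 0.
  by rewrite det2E !mxE /= mul0r subr0 mulr1 oner_eq0.
have /eqP/comm2P[e1 e2 _] := gA _ d1; have /eqP/comm2P[e3 _ _] := gA _ d2.
rewrite !mxE /= in e1 e2 e3.
exists (GLval g 0 0); apply: scalar2.
- by rewrite -[LHS]mulr1 e3 mul0r.
- by rewrite -[LHS]mul1r -e1 mulr0.
- by apply/esym/eqP; rewrite -subr_eq0 -opprB oppr_eq0 -[_ - _]mul1r -e2 subrr mulr0.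
Qed.

Lemma lift_proj x (g : {'GL_2[F]}) : coset Z g = x ->
  exists2 c, c != 0 & lift x = c *: GLval g.
Proof.
move=> gx; have : repr x \in coset Z g by rewrite gx mem_repr_coset.
rewrite val_coset ?GL_normZ // => /rcosetP[z /GL_centerP[c zc] e].
have lE : lift x = c *: GLval g by rewrite /lift e (GL_MxE z g) zc mul_scalar_mx.
exists c => //; apply: contra_neq (lift_det x) => c0.
by rewrite lE c0 scale0r det0.
Qed.

Lemma lift_surj A : \det A != 0 -> exists x c, c != 0 /\ lift x = c *: A.
Proof.
move=> dA; have Au : (A : 'M_2.-1.+1) \is a GRing.unit.
  by rewrite -[_ \is a _]/(_ \in unitmx) unitmxE unitfE.
have [c c0 e] := lift_proj (erefl (coset Z (FinRing.Unit Au : {'GL_2[F]}))).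
by exists (coset Z (FinRing.Unit Au : {'GL_2[F]})), c.
Qed.

Lemma lift1 : lift 1%g = 1%:M.
Proof. by rewrite /lift repr_coset1. Qed.

Lemma liftM x y : exists2 c, c != 0 & lift (x * y)%g = c *: (lift x *m lift y).
Proof.
rewrite /lift -(GL_MxE (repr x) (repr y)); apply: lift_proj.
by rewrite morphM ?GL_normZ //= !coset_reprK.
Qed.

Lemma lift_inj x y c : c != 0 -> lift x = c *: lift y -> x = y.
Proof.
move=> c0 e; rewrite -[x]coset_reprK -[y]coset_reprK.
apply/rcoset_kercosetP; rewrite ?GL_normZ // mem_rcoset.
apply/GL_centerP; exists c.
rewrite (GL_MxE (repr x)) -[GLval (repr x)]/(lift x) e -scalemxAl.
by rewrite -[lift y *m _](GL_MxE (repr y)) mulgV scalemx1.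
Qed.


(** Stricter than commuting in PGL_2, where lifts may also anticommute; independent of the choice of
    lifts. *)
Definition lcomm : rel PGL := fun x y => lift x *m lift y == lift y *m lift x.

Lemma lift_scalar x : lift x = (lift x 0 0)%:M -> x = 1%g.
Proof.
move=> e; apply: (@lift_inj _ _ (lift x 0 0)); last by rewrite lift1 scalemx1.
by apply: contra_neq (lift_det x) => c0; rewrite e c0 -scalemx1 scale0r det0.
Qed.

Lemma lift_nonscalar x : x != 1%g -> lift x <> (lift x 0 0)%:M.
Proof. by move=> /eqP x1 /lift_scalar. Qed.

Lemma mulmx_eqMr A B C : \det C != 0 -> C *m A = C *m B -> A = B.
Proof.
move=> dC /(congr1 (mulmx (invmx C))); rewrite !mulKmx //;
  by rewrite unitmxE unitfE.
Qed.

Lemma lcomm_commute x y : lcomm x y -> commute x y.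
Proof.
move/eqP=> e; have [c c0 e1] := liftM x y; have [d d0 e2] := liftM y x.
apply: (@lift_inj _ _ (c / d)); first by rewrite mulf_neq0 ?invr_eq0.
by rewrite e1 e2 scalerA divfK // e.
Qed.

Lemma lcommM x y z : lcomm x y -> lcomm x z -> lcomm x (y * z)%g.
Proof.
move=> /eqP e1 /eqP e2; apply/eqP; have [c c0 ->] := liftM y z.
by rewrite -scalemxAr -scalemxAl mulmxA e1 -!mulmxA e2.
Qed.

Lemma lcommJ x y z : lcomm x y -> lcomm (x ^ z)%g (y ^ z)%g.
Proof.
have liftJ u : exists2 c, c != 0 & lift z *m lift (u ^ z)%g = c *: (lift u *m lift z).
  have [c c0 e1] := liftM z (u ^ z)%g; have [d d0 e2] := liftM u z.
  exists (c^-1 * d); first by rewrite mulf_neq0 ?invr_eq0.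
  by rewrite -scalerA -e2 conjgC e1 scalerA mulVf // scale1r.
move=> /eqP e; have [c c0 e1] := liftJ x; have [d d0 e2] := liftJ y.
apply/eqP/(mulmx_eqMr (lift_det z)); rewrite !mulmxA e1 e2 -!scalemxAl -!mulmxA e1 e2.
by rewrite -!scalemxAr !scalerA mulrC !mulmxA e.
Qed.

Lemma lcomm_trans y x z : y != 1%g -> lcomm x y -> lcomm y z -> lcomm x z.
Proof.
by move=> /lift_nonscalar ny /eqP xy /eqP yz; apply/eqP; apply: comm2_trans xy yz.
Qed.

Lemma invol_lift u : #[u]%g = 2 -> u != 1%g /\ \tr (lift u) = 0.
Proof.
move/eqP/order2P=> [u1 uu]; split=> //.
have [c c0] := liftM u u; rewrite uu lift1 => e.
apply: (@tr_sqr_scalar _ _ c^-1); last exact: lift_nonscalar.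
by rewrite -scalemx1 e scalerA mulVf // scale1r.
Qed.

(** Lifts of commuting elements commute up to a factor, and comparing determinants shows that its
    square is 1. *)
Lemma commute_lift x y : commute x y ->
  exists2 e, e ^+ 2 = 1 & lift x *m lift y = e *: (lift y *m lift x).
Proof.
move=> xy; have [c c0 e1] := liftM x y; have [d d0 e2] := liftM y x.
rewrite (xy : (x * y = y * x)%g) in e1.
have E : lift x *m lift y = (c^-1 * d) *: (lift y *m lift x).
  by rewrite -scalerA -e2 e1 scalerA mulVf // scale1r.
exists (c^-1 * d) => //.
have := congr1 determinant E; rewrite detZ !det_mulmx [\det (lift y) * _]mulrC.
rewrite -[LHS]mul1r => /mulIf e; apply/esym/e.
by rewrite mulf_neq0 ?lift_det.
Qed.

Lemma invol_lcomm_eq u v : (2 : F) != 0 ->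
  #[u]%g = 2 -> #[v]%g = 2 -> lcomm u v -> u = v.
Proof.
move=> two /invol_lift[u1 tu] /invol_lift[v1 tv] /eqP/comm2_span.
case/(_ (lift_nonscalar v1)) => k [l e].
have l0 : l = 0.
  move: tu; rewrite e mxtraceD mxtraceZ tv mulr0 add0r mxtrace_scalar.
  by rewrite -mulr_natl => /eqP; rewrite mulf_eq0 (negPf two) => /eqP.
rewrite l0 -scalemx1 scale0r addr0 in e; apply: (lift_inj _ e).
by apply: contra_neq (lift_det u) => k0; rewrite e k0 scale0r det0.
Qed.

Lemma anti_lift u x : (2 : F) != 0 -> #[u]%g = 2 -> commute x u -> ~~ lcomm u x ->
  lift x *m lift u = - (lift u *m lift x).
Proof.
move=> two u2 /commute_lift[e /eqP]; rewrite sqrf_eq1 => /orP[]/eqP-> E nL.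
  by case/negP: nL; rewrite /lcomm E scale1r.
by rewrite E scaleN1r.
Qed.

(** Euler's criterion: for odd q this says that the determinant is a nonsquare, so that [x] lies
    outside PSL_2(q). Rescaling the lift multiplies the determinant by a square. *)
Definition nonsq x := \det (lift x) ^+ (#|F|.-1)./2 != 1.

Section Odd.
Hypothesis two : (2 : F) != 0.

Lemma finField_odd : odd #|F|.
Proof.
apply: contraNT two => ev; have := expf_card (-1 : F).
by rewrite -signr_odd (negPf ev) => /eqP; rewrite -subr_eq0 opprK.
Qed.

Lemma expf_half (a : F) : a != 0 -> (a ^+ (#|F|.-1)./2) ^+ 2 = 1.
Proof.
move=> a0; rewrite -exprM; suff -> : ((#|F|.-1)./2 * 2 = #|F|.-1)%N.
  apply: (mulfI a0); rewrite -exprS mulr1 prednK ?expf_card //.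
  exact: ltnW (finNzRing_gt1 F).
have := finField_odd; case: #|F| => //= n nodd.
by rewrite muln2 -[RHS]odd_double_half (negPf nodd).
Qed.

Lemma nonsqM x y : nonsq (x * y)%g = nonsq x (+) nonsq y.
Proof.
have [c c0 e] := liftM x y; rewrite /nonsq e detZ det_mulmx !exprMn -expr2.
rewrite expf_half // mul1r.
have := expf_half (lift_det x); have := expf_half (lift_det y).
have n1 : (-1 : F) != 1 by rewrite eq_sym -subr_eq0 opprK.
move/eqP; rewrite sqrf_eq1 => /orP[]/eqP-> /eqP; rewrite sqrf_eq1 => /orP[]/eqP->;
  by rewrite ?mulr1 ?mul1r ?mulrNN ?mulr1 ?eqxx ?n1.
Qed.

(** With m = (q - 1)/2 the polynomial X^m - 1 has fewer than q - 1 roots; a nonzero nonroot [a]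
    gives the class of diag(a, 1). *)
Lemma exists_nonsq : exists x, nonsq x.
Proof.
have [a a0 am] : exists2 a : F, a != 0 & a ^+ (#|F|.-1)./2 != 1.
  apply/exists_inP; apply: contraT; rewrite negb_exists_in => /forall_inP all1.
  set m := (#|F|.-1)./2.
  have q3 : (2 < #|F|)%N.
    have := finField_odd; have := finNzRing_gt1 F; by case: #|F| => [|[|[|]]].
  have m0 : (0 < m)%N by rewrite /m; move: q3; case: #|F| => [|[|[|]]].
  have := @max_poly_roots _ ('X^m - 1 : {poly F}) (enum [pred a : F | a != 0]).
  rewrite size_XnsubC // monic_neq0 ?monicXnsubC // enum_uniq -cardE cardC1 => /(_ isT).
  have -> : all (root ('X^m - 1)) (enum [pred a : F | a != 0]).
    apply/allP => a; rewrite mem_enum inE => /all1; rewrite negbK => /eqP e.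
    by rewrite rootE !hornerE /= e subrr.
  rewrite ltnS => /(_ isT isT); rewrite leqNgt => /negP[].
  rewrite /m -divn2 ltn_divLR // muln2 -addnn.
  by rewrite -[X in (X < _)%N]addn0 ltn_add2l; move: q3; case: #|F| => [|[|]].
have d : \det (diag_mx (\row_(i < 2) if i == 0 then a else 1)) != 0.
  by rewrite det2E !mxE /= mulr0n mulr1n mul0r subr0 mulr1.
have [x [c [c0 e]]] := lift_surj d; exists x; rewrite /nonsq e detZ exprMn exprAC.
by rewrite expf_half // mul1r det2E !mxE /= mulr0n mulr1n mul0r subr0 mulr1.
Qed.

Lemma PGL_torus_rel : torus_rel lcomm nonsq.
Proof.
split.
- by move=> x; apply: eqxx.
- by move=> x y; apply: eq_sym.
- by move=> x; apply/eqP; rewrite lift1 mulmx1 mul1mx.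
- exact: lcommM.
- move=> x y z; apply/idP/idP => [h|]; last exact: lcommJ.
  by rewrite -(conjgK z x) -(conjgK z y) lcommJ.
- exact: lcomm_trans.
- exact: lcomm_commute.
- by move=> u v; apply: invol_lcomm_eq two.
- move=> u x y u2 xu yu nx ny; apply/eqP; have [c c0 ->] := liftM x y.
  rewrite -scalemxAr -scalemxAl; congr (_ *: _).
  rewrite -[RHS]mulmxA (anti_lift two u2 yu ny) mulmxN [X in - X]mulmxA.
  by rewrite (anti_lift two u2 xu nx) mulNmx opprK mulmxA.
- exact: nonsqM.
Qed.

Lemma expg3_lift x : x != 1%g ->
  (x ^+ 3)%g = 1%g <-> \tr (lift x) ^+ 2 = \det (lift x).
Proof.
move=> x1; have [c c0 e2] := liftM x x; have [d d0] := liftM (x * x)%g x.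
rewrite e2 -scalemxAl scalerA (_ : x * x * x = x ^+ 3)%g; last by rewrite -mulgA.
move=> e.
have dc0 : d * c != 0 by rewrite mulf_neq0.
split=> [x3|t2].
  apply: (@mul3_scalar_tr _ _ (d * c)^-1); last exact: lift_nonscalar.
  by rewrite -scalemx1 -lift1 -x3 e scalerA mulVf // scale1r.
apply: lift_scalar; rewrite e (mul3_scalar t2) -scalemx1 !scalerA.
by rewrite scalemx1 !mxE /= mulr1n.
Qed.

Lemma expg4_lift x : (x ^+ 2)%g != 1%g -> (x ^+ 4)%g = 1%g ->
  \tr (lift x) ^+ 2 = 2 * \det (lift x).
Proof.
move=> x2 x4; have [c c0 e] := liftM x x.
have /invol_lift[_] : #[x * x]%g = 2.
  by apply/eqP/order2P; split=> //; rewrite -[(x * x)%g]/((x ^+ 2)%g) -expgD.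
rewrite e mxtraceZ tr_mul2 => /eqP; rewrite mulf_eq0 (negPf c0) /= subr_eq0.
by move/eqP.
Qed.

Lemma tr_commute_invol u v : #[u]%g = 2 -> #[v]%g = 2 -> u <> v -> commute u v ->
  \tr (lift u *m lift v) = 0.
Proof.
move=> u2 v2 nuv uv; have nL := nL_invol PGL_torus_rel v2 u2 (nesym nuv).
have := congr1 mxtrace (anti_lift two v2 uv nL); rewrite raddfN /= mxtrace_mulC.
move/eqP; rewrite -addr_eq0 -mulr2n -mulr_natl mulf_eq0 (negPf two) => /eqP.
by rewrite mxtrace_mulC.
Qed.

(** The squared trace divided by the determinant is unchanged by rescaling, so it may be computed on
    the product of the lifts. *)
Lemma liftM_tr x y : \tr (lift (x * y)%g) ^+ 2 * \det (lift x *m lift y)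
  = \tr (lift x *m lift y) ^+ 2 * \det (lift (x * y)%g).
Proof. by have [c c0 ->] := liftM x y; rewrite mxtraceZ detZ; ring. Qed.

Lemma string4_sgn_char5 a b c d : indep_string4 a b c d -> nonsq a ->
  [/\ (5 : F) = 0, (a * b) ^+ 3 = 1, (b * c) ^+ 3 = 1 & (c * d) ^+ 3 = 1]%g.
Proof.
move=> I4 sa; have [ab3 cd3 alt] := string4_orders PGL_torus_rel I4 sa.
have [a2 b2 c2 d2 ac ad bd na nb nc nd] := I4.
have [ab' ac' ad' bc' [bd' cd']] := indep_string4_neq I4.
have [_ tA] := invol_lift a2; have [_ tB] := invol_lift b2.
have [_ tC] := invol_lift c2; have [_ tD] := invol_lift d2.
have AC := tr_commute_invol a2 c2 ac' ac; have AD := tr_commute_invol a2 d2 ad' ad.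
have BD := tr_commute_invol b2 d2 bd' bd.
have trM k x y : \tr (lift (x * y)%g) ^+ 2 = k * \det (lift (x * y)%g) ->
    \tr (lift x *m lift y) ^+ 2 = k * (\det (lift x) * \det (lift y)).
  move=> e; apply: (mulIf (lift_det (x * y)%g)).
  by rewrite -liftM_tr e det_mulmx; ring.
have e3 x y : #[x]%g = 2 -> #[y]%g = 2 -> x <> y ->
    ((x * y) ^+ 3 = 1)%g -> \tr (lift x *m lift y) ^+ 2 = \det (lift x) * \det (lift y).
  move=> x2 y2 xy /(expg3_lift (mulg_invol x2 y2 xy)) e.
  by rewrite -[RHS]mul1r; apply: trM; rewrite mul1r.
have eAB := e3 _ _ a2 b2 ab' ab3; have eCD := e3 _ _ c2 d2 cd' cd3.
have := gram4_string tA tB tC tD AC AD BD; rewrite eAB eCD.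
have := lift_det a; have := lift_det b; have := lift_det c; have := lift_det d.
set dA := \det (lift a) in eAB *; set dB := \det (lift b) in eAB *.
set dC := \det (lift c) in eCD *; set dD := \det (lift d) in eCD * => d0 c0 b0 a0 gram.
(* With t the squared trace of [lift b *m lift c], the Gram relation reads 17 dA dB dC dD = 8 dA dB
   dC dD + 4 dA dD t. *)
have eBC : 4 * \tr (lift b *m lift c) ^+ 2 = 9 * (dB * dC).
  by apply: (mulfI (mulf_neq0 a0 d0)); apply: (eq_sub_eq (esym gram)); ring.
have bc0 : dB * dC != 0 by rewrite mulf_neq0.
(* If [b * c] has order 4, then t = 2 dB dC and 8 = 9, which is absurd. If [a * b * c] has order 4,
   the three-vector formula gives t = dB dC, hence 4 = 9 and order 3 for [b * c]. *)
have [{alt}[n2 e4]|{alt}[n2 e4]] := alt.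
  have e := trM 2 _ _ (expg4_lift n2 e4); rewrite -/dB -/dC in e; rewrite e in eBC.
  case/eqP: bc0; apply: (eq_sub_eq (esym eBC)); ring.
have e : \tr (lift b *m lift c) ^+ 2 = dB * dC.
  have := trM 2 _ _ (expg4_lift n2 e4).
  have [k k0 ek] := liftM a b; rewrite ek -scalemxAl mxtraceZ exprMn tr_mul3_sqr //.
  rewrite eAB detZ det_mulmx -/dA -/dB -/dC => e.
  apply: (mulfI (mulf_neq0 a0 (mulf_neq0 k0 k0))).
  by apply: (eq_sub_eq (esym e)); ring.
split=> //; last first.
  apply/(expg3_lift (mulg_invol b2 c2 bc')).
  apply: (mulIf bc0); have := liftM_tr b c; rewrite det_mulmx -/dB -/dC e => ->.
  by rewrite mulrC.
by apply: (mulIf bc0); apply: (eq_sub_eq (esym eBC)); rewrite e; ring.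
Qed.

(** If neither [a] nor [d] has nontrivial sign, then by [sgn_facet] no generator has, and the string
    generates a proper subgroup. *)
Lemma string4_char5 a b c d : indep_string4 a b c d ->
    <<[set a; b; c; d]>>%g = [set: PGL] ->
  [/\ (5 : F) = 0, (a * b) ^+ 3 = 1, (b * c) ^+ 3 = 1 & (c * d) ^+ 3 = 1]%g.
Proof.
move=> I4 gen; have I4' := indep_string4_rev I4.
have tr := PGL_torus_rel.
have [sa|sa] := boolP (nonsq a); first exact: string4_sgn_char5.
have [sd|sd] := boolP (nonsq d).
  have [e5 dc cb ba] := string4_sgn_char5 I4' sd.
  have rev x y : (#[x] = 2 -> #[y] = 2 -> (x * y) ^+ 3 = 1 -> (y * x) ^+ 3 = 1)%g.
    by move=> x2 y2 e; apply: invg_inj; rewrite -expgVn invMg (invg2id x2) (invg2id y2) e invg1.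
  have [a2 b2 c2 d2 _ _ _ _ _ _ _] := I4.
  by split=> //; apply: rev.
have [x sx] := exists_nonsq.
have kg : group_set [set y | ~~ nonsq y].
  apply/group_setP; split=> [|y z]; rewrite !inE ?(sgn1 tr) // nonsqM.
  by case: nonsq; case: nonsq.
have : <<[set a; b; c; d]>>%g \subset group kg.
  rewrite gen_subG; apply/subsetP => y; rewrite !inE -!orbA.
  by case/or4P=> /eqP->; rewrite ?(sgn_facet tr I4) ?(sgn_facet tr I4').
by rewrite gen => /subsetP/(_ x (in_setT x)); rewrite inE sx.
Qed.

(** For [a], [b] at one end of a string of length 5 and [d], [e] at the other: only one involution
    is orthogonal to both [d] and [e]. *)
Lemma string5_absurd (a b d e : PGL) : #[a]%g = 2 -> #[b]%g = 2 -> #[d]%g = 2 -> #[e]%g = 2 ->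
  a <> b -> d <> e -> commute a d -> commute a e -> commute b d -> commute b e ->
  a <> d -> a <> e -> b <> d -> b <> e -> False.
Proof. by move=> a2 b2 d2 e2 ab de *; apply: ab; apply: (pole_uniq PGL_torus_rel d2 e2). Qed.

End Odd.

Lemma char2_lcomm x y : (2 : F) = 0 -> commute x y -> lcomm x y.
Proof.
move=> two /commute_lift[e /eqP]; rewrite sqrf_eq1 => e1 E; rewrite /lcomm E.
have -> : e = 1; last by rewrite scale1r.
have m1 : (-1 : F) = 1 by apply/eqP; rewrite eq_sym -subr_eq0 opprK; apply/eqP.
by case/orP: e1 => /eqP->.
Qed.

Lemma PGL_nonabelian : ~ (forall x y, lcomm x y).
Proof.
move=> all.
have d1 : \det (\matrix_(i < 2, j < 2) (i <= j)%N%:R : 'M[F]_2) != 0.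
  by rewrite det2E !mxE /= mulr0 subr0 mulr1 oner_eq0.
have d2 : \det (\matrix_(i < 2, j < 2) (j <= i)%N%:R : 'M[F]_2) != 0.
  by rewrite det2E !mxE /= mul0r subr0 mulr1 oner_eq0.
have [x [c [c0 e1]]] := lift_surj d1; have [y [d [d0 e2]]] := lift_surj d2.
have /comm2P[+ _ _] := all x y; rewrite e1 e2 !mxE /= !mulr1 !mulr0 => /eqP.
by rewrite mulf_eq0 (negPf c0) (negPf d0).
Qed.

(** The centre has at most q - 1 elements. A lower bound is what has to meet the upper bound from
    the Coxeter relations. *)
Lemma card_PGL2_ge : (#|F| * #|F|.-1 * #|F|.+1 <= #|PGL2 F|)%N.
Proof.
have cZ : (#|Z| <= #|F|.-1)%N.
  rewrite -(cardC1 (0 : F)).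
  have inj : {in Z &, injective (fun g : {'GL_2[F]} => GLval g 0 0)}.
    move=> g h /GL_centerP[c gc] /GL_centerP[d hd] /=; rewrite gc hd !mxE /= !mulr1n => cd.
    by apply: val_inj; rewrite -[val g]/(GLval g) -[val h]/(GLval h) gc hd cd.
  rewrite -(card_in_imset inj); apply/subset_leq_card/subsetP => _ /imsetP[g /GL_centerP[c gc] ->].
  rewrite !inE; apply: contra_neq (GL_det g); rewrite gc !mxE /= mulr1n => ->.
  by rewrite -scalemx1 scale0r det0.
have q1 := ltnW (finNzRing_gt1 F).
rewrite -(leq_pmul2r (cardG_gt0 Z)); apply: (@leq_trans (#|F| * #|F|.-1 * #|F|.+1 * #|F|.-1)%N).
  by rewrite leq_mul2l cZ orbT.
have -> : (#|F| * #|F|.-1 * #|F|.+1 * #|F|.-1)%N = #|'GL_2[F]|%g.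
  by rewrite card_GL_2; lia.
rewrite /PGL2 /= card_quotient ?(normal_norm (center_normal _)) //.
by rewrite mulnC Lagrange // center_sub.
Qed.

End PGL.

(** * Coxeter groups of type A *)

Section Coxeter.
Local Open Scope group_scope.

Definition string_gens (gT : finGroupType) (r : nat -> gT) (n : nat) : {set gT} :=
  [set r i | i : 'I_n].

(* The generators fixing the base face with m vertices. *)
Definition para_gens (gT : finGroupType) (r : nat -> gT) (n m : nat) : {set gT} :=
  [set r i | i : 'I_n & i.+1 != m].

(** The relations of the Coxeter group of type A_n; indexing by [nat] lets the same [r] serve in
    smaller ranks. *)
Record coxeterA (gT : finGroupType) (r : nat -> gT) (n : nat) : Prop := CoxeterA {
  cox_sq : forall i, (i < n)%N -> r i * r i = 1;
  cox_braid : forall i, (i.+1 < n)%N -> r i * r i.+1 * r i = r i.+1 * r i * r i.+1;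
  cox_comm : forall i j, (i.+1 < j)%N -> (j < n)%N -> commute (r i) (r j)
}.

Lemma mem_string_gens (gT : finGroupType) (r : nat -> gT) n i :
  (i < n)%N -> r i \in string_gens r n.
Proof. by move=> lin; apply/imsetP; exists (Ordinal lin). Qed.

Lemma mem_para_gens (gT : finGroupType) (r : nat -> gT) n m i :
  (i < n)%N -> i.+1 != m -> r i \in para_gens r n m.
Proof. by move=> lin im; apply/imsetP; exists (Ordinal lin) => //; rewrite inE. Qed.

(** The elements whose right translation preserves [U] form a group containing [S], and they map 1
    into [U]. *)
Lemma gen_sub_closed (gT : finGroupType) (S U : {set gT}) :
  1 \in U -> (forall u s, u \in U -> s \in S -> u * s \in U) -> <<S>> \subset U.
Proof.
move=> U1 US; have gK : group_set [set g | U :* g \subset U].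
  apply/group_setP; split=> [|g h]; rewrite !inE ?mulg1 // => gU hU.
  by rewrite rcosetM; apply: subset_trans hU; apply: mulSg.
have /subsetP SK : <<S>> \subset group gK.
  rewrite gen_subG; apply/subsetP=> s sS; rewrite inE.
  by apply/subsetP=> _ /rcosetP[u uU ->]; apply: US.
apply/subsetP=> g /SK; rewrite inE => /subsetP; apply.
by apply/rcosetP; exists 1; rewrite ?mul1g.
Qed.

Section Bound.
Variables (gT : finGroupType) (r : nat -> gT) (n : nat).
Hypothesis cox : coxeterA r n.+1.

(* Representatives of the cosets of the parabolic subgroup generated by
   r_0, ..., r_(n-1). *)
Fixpoint cosetrep k := if k is k'.+1 then cosetrep k' * r (n - k') else 1.

Lemma cosetrep_commute k j : (j + k < n)%N -> commute (r j) (cosetrep k).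
Proof.
elim: k => [|k IH] jk /=; first exact: commute1.
apply: commuteM; first by apply: IH; lia.
by apply: (cox_comm cox); lia.
Qed.

(** In this range [r i] and [r i.-1] are consecutive factors of the representative: [r i] moves left
    to them, and the braid relation turns it into [r i.-1]. *)
Lemma cosetrep_shift k i : (i <= n)%N -> (k <= n.+1)%N -> (n.+2 <= i + k)%N ->
  cosetrep k * r i = r i.-1 * cosetrep k.
Proof.
elim: k => [|k IH] lin lkn; first lia.
move=> h; have [e|ne] := eqVneq (i + k) n.+1.
  case: k e IH lkn h => [|k] e IH lkn h; first lia.
  have -> : cosetrep k.+2 = cosetrep k * r i * r i.-1.
    by rewrite /=; congr (_ * r _ * r _); lia.
  have b := @cox_braid _ _ _ cox i.-1 _; rewrite prednK in b; last lia.
  rewrite -!mulgA (mulgA (r i)) -b; last lia.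
  by rewrite !mulgA (@cosetrep_commute k i.-1) //; lia.
have rC : r (n - k) * r i = r i * r (n - k) by apply: (cox_comm cox); lia.
by rewrite /= -mulgA rC mulgA IH ?mulgA //; lia.
Qed.

Lemma card_coxeter_step : (#|<<string_gens r n.+1>>| <= n.+2 * #|<<string_gens r n>>|)%N.
Proof.
set H := <<string_gens r n>>.
(* A union of n + 2 right cosets of [H]. Multiplying the k-th representative by [r i] lengthens it
   if i + k = n, shortens it if i + k = n + 1, and otherwise carries an element of [H] across to the
   left. *)
pose U := [set g.1 * cosetrep (val g.2) | g in setX H [set: 'I_n.+2]].
have memU h k : (k < n.+2)%N -> h \in H -> h * cosetrep k \in U.
  by move=> lk hH; apply/imsetP; exists (h, Ordinal lk); rewrite // !inE hH.
have sub : <<string_gens r n.+1>> \subset U.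
  apply: gen_sub_closed.
    by rewrite -[1]mulg1; apply: (memU 1 0%N).
  move=> u s /imsetP[[h [k lk]] /setXP[/= hH _] -> /=] /imsetP[[i li] _ -> /=].
  rewrite -mulgA.
  have rH j : (j < n)%N -> r j \in H by move=> lj; apply/mem_gen/mem_string_gens.
  have [e|ne] := eqVneq (i + k) n.
    have -> : cosetrep k * r i = cosetrep k.+1 by rewrite /=; congr (_ * r _); lia.
    by apply: memU; lia.
  have [e1|ne1] := eqVneq (i + k) n.+1.
    case: k lk ne e1 => [|k] lk ne e1; first lia.
    have -> : cosetrep k.+1 * r i = cosetrep k.
      by rewrite /= (_ : (n - k)%N = i); [rewrite -mulgA (cox_sq cox) ?mulg1|lia].
    by apply: memU; lia.
  have [lt|ge] := ltnP (i + k) n.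
    by rewrite -(cosetrep_commute lt) mulgA memU ?groupM ?rH //; lia.
  rewrite cosetrep_shift; [|lia|lia|lia].
  by rewrite mulgA memU ?groupM ?rH //; lia.
apply: leq_trans (subset_leq_card sub) _.
apply: leq_trans (leq_imset_card _ _) _.
by rewrite cardsX cardsT card_ord mulnC.
Qed.

End Bound.

Lemma coxeter_card (gT : finGroupType) (r : nat -> gT) n :
  coxeterA r n -> (#|<<string_gens r n>>| <= n.+1`!)%N.
Proof.
elim: n => [|n IH] cox.
  have -> : string_gens r 0 = set0 by apply/setP=> x; rewrite inE; apply/imsetP=> -[[]].
  by rewrite gen0 cards1.
apply: leq_trans (card_coxeter_step cox) _; rewrite factS leq_mul2l /=.
by apply: IH; case: cox => c1 c2 c3; split=> *; [apply: c1|apply: c2|apply: c3]; lia.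
Qed.

(** * Adjacent transpositions and Young subgroups *)

Lemma perm_block_gen (T : finType) (B : T -> bool) (K : {group {perm T}}) (s : {perm T}) :
  (forall x y, B x = B y -> tperm x y \in K) -> (forall x, B (s x) = B x) -> s \in K.
Proof.
move=> tK; have [m] := ubnP #|[set x | s x != x]|; elim: m s => // m IH s; rewrite ltnS => sm sB.
have [/eqP e|/set0Pn[x]] := boolP ([set x | s x != x] == set0).
  suff -> : s = 1 by [].
  apply/permP=> x; rewrite perm1; apply/eqP; apply: contraT => sx.
  by have := in_set0 x; rewrite -e inE sx.
(* [s * t] fixes [x] and every point fixed by [s], so its support is smaller. *)
rewrite inE => sx; set t := tperm x (s x).
have -> : s = s * t * t by rewrite -mulgA tperm2 mulg1.
have tx : t \in K by apply: tK; rewrite sB.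
rewrite groupMr //; apply: IH => [|y]; last first.
  by rewrite permM /t; case: tpermP => [e|e|_ _]; [rewrite sB -e|rewrite -(sB x) -e|]; rewrite sB.
apply: leq_trans sm; apply: proper_card; apply/properP; split; last first.
  by exists x; rewrite !inE ?sx // permM tpermR eqxx.
apply/subsetP=> y; rewrite !inE permM; apply: contra => /eqP sy.
rewrite sy /t; case: tpermP sy => [->|->|//] h; last by move/perm_inj: h => h; rewrite h eqxx in sx.
by rewrite h eqxx in sx.
Qed.

Definition adj_tperm n i : {perm 'I_n.+1} := tperm (inord i) (inord i.+1).

Lemma adj_tperm_block n (K : {group {perm 'I_n.+1}}) (a b : 'I_n.+1) :
  (forall i, (i < n)%N -> (a <= i < b)%N -> adj_tperm n i \in K) -> (a <= b)%N ->
  tperm a b \in K.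
Proof.
move=> tK; have [m] := ubnP (b - a)%N; elim: m b tK => // m IH b tK bm.
rewrite leq_eqVlt => /orP[/eqP/val_inj ->|ab]; first by rewrite tperm1.
have bn := ltn_ord b; have [c ec] : exists c : 'I_n.+1, b = c.+1 :> nat.
  by exists (inord b.-1); rewrite inordK; lia.
have Kcb : tperm c b \in K.
  have := tK c _ _; rewrite /adj_tperm inord_val -ec inord_val; apply; lia.
have [e|ne] := eqVneq a c; first by rewrite e.
have -> : tperm a b = tperm a c ^ tperm c b.
  by rewrite tpermJ tpermL tpermD // -(inj_eq val_inj) /=; move: ne; rewrite -(inj_eq val_inj) /=; lia.
rewrite groupJ // IH //; [move=> i ? ?; apply: tK|..]; lia.
Qed.

Lemma inord_eq n i j : (i <= n)%N -> (j <= n)%N -> (inord i == inord j :> 'I_n.+1) = (i == j).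
Proof. by move=> li lj; rewrite -(inj_eq val_inj) /= !inordK. Qed.

Lemma coxeterA_tperm n : coxeterA (adj_tperm n) n.
Proof.
split=> [i li|i li|i j ij jn]; first exact: tperm2.
  have tJ s t : t = t^-1 -> t * s * t = s ^ t :> {perm 'I_n.+1}.
    by move=> e; rewrite /conjg -e mulgA.
  rewrite !tJ ?tpermV // /adj_tperm.
  set x : 'I_n.+1 := inord i; set y : 'I_n.+1 := inord i.+1; set z : 'I_n.+1 := inord i.+2.
  have xz : x != z by rewrite inord_eq; lia.
  have yz : y != z by rewrite inord_eq; lia.
  have xy : x != y by rewrite inord_eq; lia.
  by rewrite !tpermJ tpermR tpermL (tpermD xz yz) (tpermD _ _) // eq_sym.
apply/commgP/conjg_fixP; rewrite /adj_tperm tpermJ !tpermD // inord_eq; lia.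
Qed.

Lemma adj_tperm_stab n m (s : {perm 'I_n.+1}) :
  (forall x : 'I_n.+1, (s x < m)%N = (x < m)%N) -> s \in <<para_gens (adj_tperm n) n m>>.
Proof.
move=> sm; pose K : {group {perm 'I_n.+1}} := <<para_gens (adj_tperm n) n m>>%G.
have main (a b : 'I_n.+1) : (a < m)%N = (b < m)%N -> (a <= b)%N -> tperm a b \in K.
  move=> eab ab; apply: adj_tperm_block => // i li /andP[ai ib].
  by apply/mem_gen/mem_para_gens => //; move: eab; lia.
apply: (perm_block_gen (K := K) (B := fun x : 'I_n.+1 => (x < m)%N)) => // x y exy.
by have [/main|/ltnW/main] := leqP x y; [apply|rewrite tpermC; apply].
Qed.

Lemma adj_tperm_gen n : <<string_gens (adj_tperm n) n>> = [set: {perm 'I_n.+1}].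
Proof.
apply/eqP; rewrite -subTset; apply/subsetP=> s _.
suff : s \in <<para_gens (adj_tperm n) n 0>>.
  by apply/subsetP/genS/subsetP=> _ /imsetP[i _ ->]; apply: mem_string_gens.
exact: adj_tperm_stab.
Qed.

Lemma adj_tperm_stabP n m s : s \in <<para_gens (adj_tperm n) n m>> ->
  forall x : 'I_n.+1, (s x < m)%N = (x < m)%N.
Proof.
have gK : group_set [set t : {perm 'I_n.+1} | [forall x, (t x < m)%N == (x < m)%N]].
  apply/group_setP; split=> [|t u]; rewrite !inE.
    by apply/forallP=> x; rewrite perm1.
  by move=> /forallP tm /forallP um; apply/forallP=> x; rewrite permM (eqP (um _)) tm.
have sub : <<para_gens (adj_tperm n) n m>> \subset group gK.
  rewrite gen_subG; apply/subsetP=> _ /imsetP[i im ->]; rewrite !inE in im *.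
  have i1 : (i.+1 < n.+1)%N by rewrite ltnS.
  have i0 : (i < n.+1)%N by apply: ltnW.
  apply/forallP=> x; rewrite /adj_tperm; case: tpermP => [->|->|//]; rewrite !inordK //;
    by apply/eqP; lia.
by move/(subsetP sub); rewrite inE => /forallP sm x; apply: (eqP (sm x)).
Qed.

(** Swapping a point of [A] outside [A'] with a point of [A'] outside [A] brings [A] closer to [A'];
    both points lie in [B]. *)
Lemma perm_subset (T : finType) (A A' B : {set T}) :
  A \subset B -> A' \subset B -> #|A| = #|A'| ->
  exists t : {perm T}, t @: A = A' /\ t @: B = B.
Proof.
have [m] := ubnP #|A :\: A'|; elim: m A => // m IH A; rewrite ltnS => Am AB A'B cA.
have [e|/set0Pn[a]] := eqVneq (A :\: A') set0.
  exists 1; have -> : A = A' by apply/eqP; rewrite eqEcard -setD_eq0 e eqxx cA /=.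
  by split; rewrite -[RHS]imset_id; apply: eq_imset => x; rewrite perm1.
rewrite inE => /andP[aA' aA].
have [b bA' bA] : exists2 b, b \in A' & b \notin A.
  apply/subsetPn; apply: contra aA' => sA'.
  by have /eqP -> : A' == A by rewrite eqEcard sA' cA /=.
have bB := subsetP A'B b bA'; have aB := subsetP AB a aA.
pose t := tperm a b.
have tB : t @: B \subset B.
  by apply/subsetP=> _ /imsetP[x xB ->]; rewrite /t; case: tpermP.
have [||||u [uA uB]] := IH (t @: A).
- apply: leq_trans Am; apply: proper_card; apply/properP; split; last first.
    exists a; first by rewrite inE aA' aA.
    rewrite inE aA' /=; apply/imsetP => -[x xA e].
    by case/negP: bA; rewrite -(_ : x = b) // -[x](tpermK a b) -e tpermL.
  apply/subsetP=> _ /setDP[/imsetP[x xA ->]]; rewrite inE => tx; rewrite tx /=.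
  move: tx; rewrite /t; case: tpermP => [_|e|//]; first by rewrite bA'.
  by case/negP: bA; rewrite -e.
- by apply: subset_trans (imsetS _ AB) tB.
- by [].
- by rewrite card_imset //; apply: perm_inj.
exists (t * u); split.
  by rewrite -uA -imset_comp; apply: eq_imset => x; rewrite permM.
rewrite -[RHS]uB -[in RHS](_ : t @: B = B); last first.
  by apply/eqP; rewrite eqEcard tB (card_imset _ (@perm_inj _ t)) leqnn.
by rewrite -imset_comp; apply: eq_imset => x; rewrite permM.
Qed.

(** The pairs of generators satisfy the same relations in the direct product, so they generate at
    most (n + 1)! elements. Both projections are onto groups at least that large, so the subgroup is
    the graph of an isomorphism. *)
Theorem coxeterA_isom (gT : finGroupType) (G : {group gT}) (r : nat -> gT) n :
  coxeterA r n -> <<string_gens r n>> = G -> (n.+1`! <= #|G|)%N ->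
  exists f : {morphism G >-> {perm 'I_n.+1}},
    isom G [set: {perm 'I_n.+1}] f /\ forall i, (i < n)%N -> f (r i) = adj_tperm n i.
Proof.
move=> cox gen Gge; have coxT := coxeterA_tperm n.
pose s i := (r i, adj_tperm n i).
have cox_s : coxeterA s n.
  by case: cox coxT => c1 c2 c3 [d1 d2 d3]; split=> *; apply: injective_projections;
     rewrite /= ?c1 ?c2 ?d1 ?d2 //; [apply: c3|apply: d3].
pose D : {group (gT * {perm 'I_n.+1})} := <<string_gens s n>>%G.
have Dle : (#|D| <= n.+1`!)%N by apply: coxeter_card.
have sD i : (i < n)%N -> s i \in D by move=> li; apply/mem_gen/mem_string_gens.
have morD (hT : finGroupType) (h : {morphism [set: gT * {perm 'I_n.+1}] >-> hT}) (x : nat -> hT) :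
    (forall i, h (s i) = x i) -> h @: D = <<string_gens x n>>.
  move=> hx; rewrite -morphimEsub ?subsetT // morphim_gen ?subsetT //; congr <<_>>.
  rewrite morphimEsub ?subsetT // /string_gens -imset_comp.
  by apply: eq_imset => i /=; apply: hx.
have e1 : fst @: D = G by rewrite -gen; apply: (morD _ (fst_morphism _ _)).
have e2 : snd @: D = [set: {perm 'I_n.+1}].
  by rewrite -adj_tperm_gen; apply: (morD _ (snd_morphism _ _)).
have cardS : #|[set: {perm 'I_n.+1}]| = n.+1`! by rewrite cardsT card_Sn.
have inj1 : {in D &, injective fst}.
  by apply/imset_injP; rewrite eqn_leq leq_imset_card e1 (leq_trans Dle).
have inj2 : {in D &, injective snd}.
  by apply/imset_injP; rewrite eqn_leq leq_imset_card e2 cardS.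
pose sel x := odflt 1 [pick g in D | g.1 == x].
have selP x : x \in G -> sel x \in D /\ (sel x).1 = x.
  rewrite -e1 => /imsetP[g gD xg]; rewrite /sel; case: pickP => [h /andP[hD /eqP]|/(_ g)] //.
  by rewrite gD xg eqxx.
have sel_uniq g : g \in D -> sel g.1 = g.
  move=> gD; have g1 : g.1 \in G by rewrite -e1; apply: imset_f.
  by have [gsD e] := selP _ g1; apply: inj1.
have fM : {in G &, {morph (fun x => (sel x).2) : x y / x * y}}.
  move=> x y /selP[xD ex] /selP[yD ey] /=.
  by rewrite -{1}ex -{1}ey -[_ * _]/((sel x * sel y).1) sel_uniq ?groupM.
exists (Morphism fM); split; last first.
  by move=> i /sD si /=; rewrite -[r i]/((s i).1) sel_uniq.
apply/isomP; split.
  apply/injmP => x y /selP[xD ex] /selP[yD ey] /= e.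
  by rewrite -ex -ey (inj2 _ _ xD yD e).
apply/setP=> t; rewrite in_setT; have : t \in snd @: D by rewrite e2.
case/imsetP=> g gD ->; apply/morphimP; exists g.1; rewrite -?e1 ?imset_f //=.
by rewrite sel_uniq.
Qed.

End Coxeter.

(** * String generators of PGL_2 *)

Section StringPGL.
Local Open Scope group_scope.
Variable F : finFieldType.

(** The common ground of polytopes and string C-groups. Independence comes from the intersection
    property for {i} and its complement, or from the base face of rank i, which the i-th reflection
    moves and the others fix. *)
Record indep_string (gT : finGroupType) (r : nat -> gT) (n : nat) : Prop := IndepString {
  is_order : forall i, (i < n)%N -> #[r i] = 2;
  is_comm : forall i j, (i.+1 < j)%N -> (j < n)%N -> commute (r i) (r j);
  is_indep : forall i, (i < n)%N -> r i \notin <<para_gens r n i.+1>>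
}.

Lemma indep_string_neq (gT : finGroupType) (r : nat -> gT) n i j :
  indep_string r n -> (i < n)%N -> (j < n)%N -> i != j -> r i <> r j.
Proof.
move=> [_ _ ind] li lj ij e; case/negP: (ind i li); rewrite e; apply: mem_gen.
by apply/imsetP; exists (Ordinal lj); rewrite // inE /= eq_sym.
Qed.

Lemma indep_string_char2 (r : nat -> coset_of 'Z('GL_2[F])) n :
  (4 <= n)%N -> indep_string r n -> <<string_gens r n>> = [set: coset_of 'Z('GL_2[F])] ->
  (2 : F)%R != 0%R.
Proof.
move=> n4 [r2 rC _] gen; apply/negP => /eqP two; apply: (@PGL_nonabelian F).
have r1 i : (i < n)%N -> r i != 1.
  by move=> li; rewrite -order_eq1 r2.
have L i j : (i.+1 < j)%N -> (j < n)%N -> lcomm (r i) (r j).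
  by move=> ij jn; apply: char2_lcomm => //; apply: rC.
have Lsym (x y : coset_of 'Z('GL_2[F])) : lcomm x y -> lcomm y x by rewrite /lcomm eq_sym.
have gK : group_set [set x | lcomm (r 0%N) x].
  apply/group_setP; split=> [|x y]; rewrite !inE; last exact: lcommM.
  by rewrite /lcomm lift1 mulmx1 mul1mx.
have : <<string_gens r n>> \subset group gK.
  rewrite gen_subG; apply/subsetP=> _ /imsetP[[i li] _ ->]; rewrite inE /=.
  case: i li => [|[|i]] li; first exact: eqxx.
    (* [r 0] and [r 1] are not adjacent to [r 3] in the string, so their lifts are linked through
       it. *)
    by apply: (@lcomm_trans _ (r 3%N)); [apply: r1|apply: L|apply/Lsym/L]; lia.
  exact: L.
rewrite gen => /subsetP all0 x y.
have := all0 x (in_setT x); have := all0 y (in_setT y); rewrite !inE => Ly Lx.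
by apply: (@lcomm_trans _ (r 0%N)); [apply: r1; lia|apply: Lsym|].
Qed.

Lemma PGL2E : PGL2 F = [set: coset_of 'Z('GL_2[F])] :> {set _}.
Proof.
rewrite /PGL2 /= /quotient -[RHS](im_coset 'Z('GL_2[F])).
by congr (_ @* _); apply/setP=> g; rewrite inE GL_normZ.
Qed.

Lemma indep_string_PGL (r : nat -> coset_of 'Z('GL_2[F])) n :
  (4 <= n)%N -> indep_string r n -> <<string_gens r n>> = [set: coset_of 'Z('GL_2[F])] ->
  [/\ n = 4, #|F| = 5 & coxeterA r n].
Proof.
move=> n4 rI gen; have two := indep_string_char2 n4 rI gen.
have [r2 rC rind] := rI; have ne i j := @indep_string_neq _ r n i j rI.
have [n5|] := ltnP 4 n.
  by case: (@string5_absurd F two (r 0%N) (r 1%N) (r 3%N) (r 4%N));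
    by [apply: r2; lia|apply: ne; lia|apply: rC; lia].
move=> n4'; have {n4 n4'} en : n = 4 by lia.
subst n.
have sub (A : {set coset_of 'Z('GL_2[F])}) i : (i < 4)%N ->
    A \subset [set r j | j : 'I_4 & val j != i] -> r i \notin <<A>>.
  by move=> li sA; apply: contra (rind i li); apply/subsetP/genS.
have mem i j : (j < 4)%N -> j != i -> r j \in [set r j | j : 'I_4 & val j != i].
  by move=> lj ji; apply/imsetP; exists (Ordinal lj) => //; rewrite inE.
have I4 : indep_string4 (r 0%N) (r 1%N) (r 2%N) (r 3%N).
  by split; try (by [apply: r2|apply: rC]); apply: sub => //;
    apply/subsetP=> x; rewrite !inE -orbA => /or3P[]/eqP->; apply: mem.
have gen4 : <<[set r 0%N; r 1%N; r 2%N; r 3%N]>> = [set: coset_of 'Z('GL_2[F])].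
  apply/eqP; rewrite -subTset -gen; apply/genS/subsetP=> _ /imsetP[[i li] _ ->] /=.
  by case: i li => [|[|[|[|]]]] // _; rewrite !inE eqxx ?orbT.
have [five ab bc cd] := string4_char5 two I4 gen4.
have cox : coxeterA r 4.
  have sq i : (i < 4)%N -> r i * r i = 1.
    by move=> li; have /eqP/order2P[] := r2 i li.
  have braid x y : x * x = 1 -> y * y = 1 -> (x * y) ^+ 3 = 1 ->
      x * y * x = y * x * y :> coset_of 'Z('GL_2[F]).
    move=> xx yy; rewrite expgS expgS expg1 => e.
    have vx : x^-1 = x by apply/eqP; rewrite eq_invg_mul xx.
    have vy : y^-1 = y by apply/eqP; rewrite eq_invg_mul yy.
    have : (x * y * x)^-1 = y * x * y by apply/eqP; rewrite eq_invg_mul -e !mulgA.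
    by rewrite !invMg vx vy mulgA.
  split=> // i li; apply: braid; rewrite ?sq //; try lia.
  by case: i li => [|[|[|]]].
have cle : (#|PGL2 F| <= 120)%N.
  by rewrite PGL2E -gen; apply: leq_trans (coxeter_card cox) _.
have dvd5 : (5 %| #|F|)%N.
  have [p p_pr pF] := finPcharP F.
  have -> : 5 = p.
    by apply/eqP; rewrite eq_sym -dvdn_prime2 // (dvdn_pcharf pF); apply/eqP.
  by rewrite (dvdn_pcharf pF) -FinRing.zmodXgE -cardsT expg_cardG ?inE.
(* A multiple of 5 other than 5 would be at least 10, and 10 * 9 * 11 exceeds 120 = 5!. *)
split=> //; have := leq_trans (card_PGL2_ge F) cle; have := finNzRing_gt1 F.
case/dvdnP: dvd5 => -[|[|m]] -> // _; rewrite leqNgt => /negP[].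
by apply: (@leq_trans (10 * 9 * 11)%N) => //; apply: leq_mul; [apply: leq_mul|]; lia.
Qed.

Theorem string_PGL (gT : finGroupType) (G : {group gT}) (r : nat -> gT) n :
    (4 <= n)%N -> G \isog PGL2 F -> indep_string r n -> <<string_gens r n>> = G ->
  [/\ n = 4, #|F| = 5 &
    exists f : {morphism G >-> {perm 'I_n.+1}},
      isom G [set: {perm 'I_n.+1}] f /\ forall i, (i < n)%N -> f (r i) = adj_tperm n i].
Proof.
move=> n4 /isogP[h injh hG] [r2 rC rind] gen.
have rG i : (i < n)%N -> r i \in G by move=> li; rewrite -gen; apply/mem_gen/mem_string_gens.
have subG (A : {set gT}) : A \subset string_gens r n -> A \subset G.
  by move=> sA; apply: subset_trans sA _; rewrite -gen sub_gen.
have hgen (P : pred 'I_n) :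
    h @* <<[set r i | i : 'I_n & P i]>> = <<[set h (r i) | i : 'I_n & P i]>>.
  have sP : [set r i | i : 'I_n & P i] \subset G.
    by apply: subG; apply/subsetP=> _ /imsetP[i _ ->]; apply: mem_string_gens.
  by rewrite morphim_gen // morphimEsub // -imset_comp.
have rI : indep_string (h \o r) n.
  split=> [i li|i j ij jn|i li] /=.
  - by rewrite order_injm ?r2 ?rG.
  - have [iG jG] : r i \in G /\ r j \in G by split; apply: rG; lia.
    by apply: (etrans (esym (morphM h iG jG))); rewrite (rC i j ij jn) morphM.
  - rewrite -hgen; apply: contra (rind i li) => /morphimP[x xG xA /(injmP injh) e].
    by rewrite e ?rG.
have gen' : <<string_gens (h \o r) n>> = [set: coset_of 'Z('GL_2[F])].
  have predTE (hT : finGroupType) (u : nat -> hT) :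
      string_gens u n = [set u i | i : 'I_n & predT i].
    by apply/setP=> x; apply/imsetP/imsetP => -[i _ ->]; exists i.
  by rewrite predTE -(hgen predT) -predTE gen -PGL2E -hG.
have [n_4 q5 cox] := indep_string_PGL n4 rI gen'.
have inj x y : x \in G -> y \in G -> h x = h y -> x = y by apply: (injmP injh).
have coxr : coxeterA r n.
  case: cox => c1 c2 c3; split=> [i li|i li|i j ij jn]; last exact: rC.
    by apply: inj; rewrite ?morphM ?groupM ?rG // (c1 i) ?morph1.
  have ri : r i \in G by apply: rG; lia.
  have rj : r i.+1 \in G by apply: rG.
  by apply: inj; rewrite ?morphM ?groupM //; apply: (c2 i).
split=> //; apply: coxeterA_isom => //.
have -> : #|G| = #|PGL2 F| by rewrite -hG card_injm.
by rewrite n_4; apply: leq_trans (card_PGL2_ge F); rewrite q5.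
Qed.

End StringPGL.

(** * Regular polytopes *)

Section Polytope.
Import boolp classical_sets functions.
Local Open Scope order_scope.
Local Open Scope classical_set_scope.
Variables (disp : Order.disp_t) (P : tbPOrderType disp) (n : nat) (rk : P -> int).
Hypothesis poly : abstract_polytope n rk.

Implicit Types (C D : set P) (x y z : P) (f : P -> P).

Lemma chain_extend C : chain C -> exists2 D, flag D & C `<=` D.
Proof.
(* Taking the union with [C] covers the empty family in Zorn's lemma, whose union is empty. *)
move=> chC; pose Q := [set D : set P | chain (C `|` D)].
have [F FQ totF|D [QD maxD]] := @Zorn_bigcup _ Q.
  have sub X Y s t : F X -> F Y -> (C `|` X) s -> (C `|` Y) t -> s <= t \/ t <= s.
    move=> FX FY sX tY; have [XY|YX] := totF X Y FX FY.
      by apply: (FQ Y FY) => //; case: sX => [|/XY]; [left|right].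
    by apply: (FQ X FX) => //; case: tY => [|/YX]; [left|right].
  move=> s t [sC|[X FX sX]] [tC|[Y FY tY]]; first exact: chC.
  - by apply: (sub Y Y) => //; [left|right].
  - by apply: (sub X X) => //; [right|left].
  - by apply: (sub X Y) => //; right.
have CD : C `<=` D.
  apply: contrapT => nCD; apply: (maxD (C `|` D)).
    by split=> [x|h]; [right|apply: nCD => x Cx; apply: h; left].
  by rewrite /Q /= setUA setUid.
exists D => //; split=> [s t Ds Dt|E chE DE]; first by apply: QD; right.
apply: contrapT => nE; apply: (maxD E); last first.
  rewrite /Q /=; suff -> : C `|` E = E by [].
  by apply/seteqP; split=> [x [/CD/DE|]|x] //; right.
by split=> // ED; apply: nE; apply/seteqP; split.
Qed.

Lemma rk_le x y : x <= y -> (rk x <= rk y)%R.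
Proof. by rewrite le_eqVlt => /orP[/eqP->//|/(rank_lt poly)/ltW]. Qed.

Lemma flag_le C x y : flag C -> C x -> C y -> (rk x <= rk y)%R -> x <= y.
Proof.
move=> [chC _] Cx Cy xy; have [//|yx] := chC x y Cx Cy.
move: yx; rewrite le_eqVlt => /orP[/eqP->//|/(rank_lt poly)].
by rewrite ltNge xy.
Qed.

Lemma chain_rk_inj C x y : chain C -> C x -> C y -> rk x = rk y -> x = y.
Proof.
move=> chC Cx Cy e; have [xy|yx] := chC x y Cx Cy; apply/eqP; apply: contraT => ne.
  have : x < y by rewrite lt_neqAle ne.
  by move/(rank_lt poly); rewrite e ltxx.
have : y < x by rewrite lt_neqAle eq_sym ne.
by move/(rank_lt poly); rewrite e ltxx.
Qed.

Lemma flag_rk_ex C (r : int) : flag C -> (-1 <= r <= Posz n)%R -> exists x, C x /\ rk x = r.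
Proof. by move=> fC /(flag_rank poly fC)[x [h _]]; exists x. Qed.

Lemma full_chain_flag C : chain C ->
  (forall r : int, (-1 <= r <= Posz n)%R -> exists x, C x /\ rk x = r) -> flag C.
Proof.
move=> chC full; split=> // D chD CD; apply/seteqP; split=> // x Dx.
have [y [Cy e]] := full (rk x) (rank_bounds poly x).
by rewrite (@chain_rk_inj D x y chD Dx (CD y Cy)).
Qed.

Lemma flag_sub C D : flag C -> flag D -> C `<=` D -> C = D.
Proof. by move=> [_ maxC] [chD _] CD; rewrite (maxC D chD CD). Qed.

Lemma flag_ex_le x y : x <= y -> exists C, [/\ flag C, C x & C y].
Proof.
move=> xy; have [s t|C fC sC] := @chain_extend [set z | z = x \/ z = y].
  by move=> [->|->] [->|->]; rewrite ?xy ?lexx; [left|left|right|left].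
by exists C; split=> //; apply: sC; [left|right].
Qed.

Lemma adj_notin j C D x : flag C -> flag D -> adjacent rk j C D -> C x -> rk x = Posz j -> ~ D x.
Proof.
move=> fC fD [ne CD] Cx xj Dx; apply: ne; apply: flag_sub => // y Cy.
have [yj|/eqP yj] := eqVneq (rk y) (Posz j); last by apply/CD.
by rewrite (chain_rk_inj fC.1 Cy Cx) // yj.
Qed.

Lemma adj_sym j C D : adjacent rk j C D -> adjacent rk j D C.
Proof. by move=> [ne CD]; split=> [e|x /CD h]; [apply: ne|split=> /h]. Qed.

Lemma adj_uniq j C D D' : (j < n)%N -> flag C -> flag D -> flag D' ->
  adjacent rk j C D -> adjacent rk j C D' -> D = D'.
Proof.
by move=> jn fC fD fD' CD CD'; have [E [_ u]] := thin poly fC jn; rewrite -(u D) // -(u D').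
Qed.

(** Induction along a flag through [x], as [f] is strictly monotone; the inverse automorphism later
    gives equality. *)
Lemma aut_rk_ge f x : automorphism f -> (rk x <= rk (f x))%R.
Proof.
move=> [_ fm]; have [m] : exists m : nat, rk x = (Posz m - 1)%R.
  by have := rank_bounds poly x; exists (absz (rk x + 1)%R); lia.
elim: m x => [|m IH] x xm; first by have := rank_bounds poly (f x); lia.
have [C [fC Cx _]] := flag_ex_le (lexx x).
have [|y [Cy ym]] := @flag_rk_ex C (Posz m - 1)%R fC; first by have := rank_bounds poly x; lia.
have yx : y < x.
  rewrite lt_neqAle (flag_le fC Cy Cx) ?andbT; last lia.
  by apply/eqP => e; move: ym; rewrite e; lia.
have : f y < f x by rewrite (leW_mono fm).
by move/(rank_lt poly); have := IH y ym; lia.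
Qed.

Lemma aut_inv f : automorphism f -> exists g, [/\ automorphism g, cancel f g & cancel g f].
Proof.
move=> [[g fK gK] fm]; exists g; split=> //; split; first by exists f.
by move=> x y; rewrite -fm !gK.
Qed.

Lemma aut_rk f x : automorphism f -> rk (f x) = rk x.
Proof.
move=> fa; have [g [ga fK _]] := aut_inv fa.
by apply: le_anti; rewrite (aut_rk_ge x fa) -{2}(fK x) (aut_rk_ge (f x) ga).
Qed.

Lemma aut_flag f C : automorphism f -> flag C -> flag (f @` C).
Proof.
move=> fa fC; apply: full_chain_flag => [_ _ [x Cx <-] [y Cy <-]|r /(flag_rk_ex fC)[x [Cx xr]]].
  by rewrite !fa.2; apply: fC.1.
by exists (f x); rewrite aut_rk //; split=> //; exists x.
Qed.

Lemma aut_adj f j C D : automorphism f -> adjacent rk j C D -> adjacent rk j (f @` C) (f @` D).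
Proof.
move=> fa [ne CD]; have [g [ga fK gK]] := aut_inv fa; split=> [e|x xj].
  apply: ne; apply/seteqP; split=> x Cx.
    have : (f @` D) (f x) by rewrite -e; exists x.
    by case=> y Dy /(can_inj fK) <-.
  have : (f @` C) (f x) by rewrite e; exists x.
  by case=> y Dy /(can_inj fK) <-.
split=> -[y Cy e]; exists y => //; apply/CD => //; by rewrite -(aut_rk y fa) e.
Qed.

(** By thinness an automorphism fixing a flag fixes its adjacent flags, hence by connectivity all
    flags, and every face lies in a flag. *)
Lemma aut_free f C : automorphism f -> flag C -> f @` C = C -> forall x, f x = x.
Proof.
move=> fa fC fCC.
have fixE D : flag D -> f @` D = D -> forall x, D x -> f x = x.
  move=> fD e x Dx; apply: (chain_rk_inj fD.1) => //; last exact: aut_rk.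
  by rewrite -e; exists x.
move=> x; have [D [fD Dx _]] := flag_ex_le (lexx x).
have [k [c [c0 ck cf cadj]]] := strongly_flag_connected poly fC fD.
suff : forall i, (i <= k)%N -> f @` (c i) = c i.
  by move/(_ k (leqnn k)); rewrite ck => /(fixE D fD); apply.
elim=> [|i IH] ik; first by rewrite c0.
have [fi _] := cf i (ltnW ik); have [fi1 _] := cf i.+1 ik.
have [j jn aj] := cadj i ik.
apply: (adj_uniq jn fi) => //; first exact: aut_flag.
by rewrite -(IH (ltnW ik)); apply: aut_adj.
Qed.

(** * The automorphism group acting on flags *)

Section AutGroup.
Variables (gT : finGroupType) (G : {group gT}) (phi : gT -> P -> P).
Hypothesis reg : regular P.
Hypothesis phi_bij : set_bij [set` G] [set f | automorphism f] phi.
Hypothesis phiM : {in G &, forall g h, phi (g * h)%g = phi g \o phi h}.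

Lemma phi_aut g : g \in G -> automorphism (phi g).
Proof. by case: phi_bij => h _ _ gG; apply: h. Qed.

Lemma phi_surj f : automorphism f -> exists2 g, g \in G & phi g = f.
Proof. by case: phi_bij => _ _ h /h[g gG e]; exists g. Qed.

Lemma phi_inj g h : g \in G -> h \in G -> phi g = phi h -> g = h.
Proof. case: phi_bij => _ inj _ gG hG; by apply: inj; apply: mem_set. Qed.

Lemma phi1 x : phi 1%g x = x.
Proof.
have [[f fK _] _] := phi_aut (group1 G); apply: (can_inj fK).
by have /(congr1 (fun h => h x)) := phiM (group1 G) (group1 G); rewrite mulg1 => /esym.
Qed.

Lemma phiME g h x : g \in G -> h \in G -> phi (g * h)%g x = phi g (phi h x).
Proof. by move=> gG hG; rewrite phiM. Qed.

Lemma phiK g : g \in G -> cancel (phi g) (phi g^-1%g).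
Proof. by move=> gG x; rewrite -phiME ?groupV // mulVg phi1. Qed.

Lemma phi_le g x y : g \in G -> (phi g x <= phi g y) = (x <= y).
Proof. by move=> /phi_aut[_ ->]. Qed.

Lemma phi_image1 C : phi 1%g @` C = C.
Proof. by apply/seteqP; split=> [_ [x Cx <-]|x Cx]; [rewrite phi1|exists x; rewrite ?phi1]. Qed.

Lemma phi_imageM g h C : g \in G -> h \in G -> phi (g * h)%g @` C = phi g @` (phi h @` C).
Proof. by move=> gG hG; rewrite phiM // image_comp. Qed.

Variable Phi : set P.
Hypothesis flagPhi : flag Phi.

Lemma phi_eq g h : g \in G -> h \in G -> phi g @` Phi = phi h @` Phi -> g = h.
Proof.
move=> gG hG e; have hgG : (h^-1 * g)%g \in G by rewrite groupM ?groupV.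
have fix_hg := @aut_free _ Phi (phi_aut hgG) flagPhi _.
apply/eqP; rewrite eq_sym eq_mulVg1; apply/eqP; apply: phi_inj => //.
apply/funext => x; rewrite phi1 fix_hg // phi_imageM ?groupV // e.
by rewrite -phi_imageM ?groupV // mulVg phi_image1.
Qed.

Lemma face_ex m : exists x, (m <= n.+1)%N -> Phi x /\ rk x = (Posz m - 1)%R.
Proof.
have [mn|nm] := leqP m n.+1; last by exists \bot; lia.
have [|x xP] := @flag_rk_ex Phi (Posz m - 1)%R flagPhi; first lia.
by exists x.
Qed.

(** Indexed by rank plus one, so that [face m] is to become a simplex face with m vertices. *)
Definition face m : P := xget \bot [set x | Phi x /\ rk x = (Posz m - 1)%R].

Lemma faceP m : (m <= n.+1)%N -> Phi (face m) /\ rk (face m) = (Posz m - 1)%R.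
Proof.
move=> mn; rewrite /face; case: xgetP => [x _ //|nox].
by have [x /(_ mn) xP] := face_ex m; case: (nox x).
Qed.

Lemma face_uniq m x : (m <= n.+1)%N -> Phi x -> rk x = (Posz m - 1)%R -> x = face m.
Proof.
by move=> mn Px xr; have [Pf fr] := faceP mn; apply: (chain_rk_inj flagPhi.1); rewrite ?fr.
Qed.

Lemma refl_ex j : exists g, (j < n)%N -> g \in G /\ adjacent rk j Phi (phi g @` Phi).
Proof.
have [jn|nj] := ltnP j n; last by exists 1%g.
have [Psi [[fPsi aj] _]] := thin poly flagPhi jn.
have [f fa fE] := reg flagPhi fPsi; have [g gG ge] := phi_surj fa.
by exists g => _; rewrite ge fE.
Qed.

Definition refl j : gT := xget 1%g [set g | g \in G /\ adjacent rk j Phi (phi g @` Phi)].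

Lemma reflP j : (j < n)%N -> refl j \in G /\ adjacent rk j Phi (phi (refl j) @` Phi).
Proof.
move=> jn; rewrite /refl; case: xgetP => [g _ //|nog].
by have [g /(_ jn) gP] := refl_ex j; case: (nog g).
Qed.

Lemma flag_phi g C : g \in G -> flag C -> flag (phi g @` C).
Proof. by move=> gG fC; apply: aut_flag => //; apply: phi_aut. Qed.

Lemma adj_phi g j C D : g \in G -> adjacent rk j C D -> adjacent rk j (phi g @` C) (phi g @` D).
Proof. by move=> gG; apply: aut_adj; apply: phi_aut. Qed.

Lemma rk_phi g x : g \in G -> rk (phi g x) = rk x.
Proof. by move=> gG; apply: aut_rk; apply: phi_aut. Qed.

Lemma refl_order j : (j < n)%N -> #[refl j]%g = 2.
Proof.
move=> jn; have [rG aj] := reflP jn; apply/eqP/order2P; split.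
  by apply/eqP => r1; case: aj => + _; rewrite r1 phi_image1.
apply: phi_eq; rewrite ?groupM // phi_image1 phi_imageM //.
have fPsi := flag_phi rG flagPhi.
exact: (adj_uniq jn fPsi (flag_phi rG fPsi) flagPhi (adj_phi rG aj) (adj_sym aj)).
Qed.

Lemma refl_comm i j : (i.+1 < j)%N -> (j < n)%N -> commute (refl i) (refl j).
Proof.
move=> ij jn; have iln : (i < n)%N by lia.
have [iG [nei ai]] := reflP iln; have [jG [nej aj]] := reflP jn.
have fi := flag_phi iG flagPhi; have fj := flag_phi jG flagPhi.
set Psi_i := phi _ @` _ in nei ai fi *; set Psi_j := phi _ @` _ in nej aj fj *.
(* The base flag with both its i-face and its j-face replaced; it will be the image of [Phi] under
   either product. *)
pose X : set P := [set x | [\/ rk x <> Posz i /\ (rk x <> Posz j /\ Phi x),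
                         rk x = Posz i /\ Psi_i x | rk x = Posz j /\ Psi_j x]].
have ij' : Posz i <> Posz j by case; lia.
have Xi x : rk x <> Posz j -> (Psi_i x <-> X x).
  move=> xj; split=> [Px|[[xi [_ Px]]|[//]|[]//]]; last by apply/ai.
  have [xi|/eqP xi] := eqVneq (rk x) (Posz i); first by apply: Or32.
  by apply: Or31; split=> //; split=> //; apply/ai.
have Xj x : rk x <> Posz i -> (Psi_j x <-> X x).
  move=> xi; split=> [Px|[[_ [xj Px]]|[]//|[//]]]; last by apply/aj.
  have [xj|/eqP xj] := eqVneq (rk x) (Posz j); first by apply: Or33.
  by apply: Or31; split=> //; split=> //; apply/aj.
have le_ij x y : X x -> X y -> rk x = Posz i -> rk y = Posz j -> x <= y.
  move=> Xx Xy xi yj.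
  (* As i + 1 < j, the base face of rank i + 1 survives in both neighbours and separates the two new
     faces. *)
  have [|z [Pz zr]] := @flag_rk_ex Phi (Posz i.+1) flagPhi; first lia.
  have Pix : Psi_i x by apply/Xi; rewrite // xi.
  have Piz : Psi_i z by apply/ai => //; rewrite zr; lia.
  have Pjy : Psi_j y by apply/Xj; rewrite // yj; lia.
  have Pjz : Psi_j z by apply/aj => //; rewrite zr; lia.
  have xz : x <= z by apply: (flag_le fi) => //; lia.
  by apply: (le_trans xz); apply: (flag_le fj) => //; lia.
have fX : flag X.
  apply: full_chain_flag => [x y Xx Xy|r rr].
    have [xj|/eqP xj] := eqVneq (rk x) (Posz j); have [yj|/eqP yj] := eqVneq (rk y) (Posz j).
    - by apply: fj.1; apply/Xj; rewrite // ?xj ?yj; apply: nesym.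
    - have [yi|/eqP yi] := eqVneq (rk y) (Posz i); first by right; apply: le_ij.
      by apply: fj.1; apply/Xj; rewrite // xj; apply: nesym.
    - have [xi|/eqP xi] := eqVneq (rk x) (Posz i); first by left; apply: le_ij.
      by apply: fj.1; apply/Xj; rewrite // yj; apply: nesym.
    - by apply: fi.1; apply/Xi.
  have [rj|/eqP rj] := eqVneq r (Posz j).
    have [x [xP xr]] := flag_rk_ex fj rr; exists x; split=> //.
    by apply/Xj; rewrite // xr rj; apply: nesym.
  have [x [xP xr]] := flag_rk_ex fi rr; exists x; split=> //.
  by apply/Xi; rewrite // xr.
have aXi : adjacent rk j Psi_i X.
  split=> // e; have [|x [xP xr]] := @flag_rk_ex _ (Posz j) fj; first lia.
  have : Psi_i x by rewrite e; apply/Xj; rewrite // xr; apply: nesym.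
  move/ai; rewrite xr => /(_ (nesym ij')).
  by apply: (adj_notin fj flagPhi (adj_sym (conj nej aj))).
have aXj : adjacent rk i Psi_j X.
  split=> // e; have [|x [xP xr]] := @flag_rk_ex _ (Posz i) fi; first lia.
  have : Psi_j x by rewrite e; apply/Xi; rewrite // xr.
  move/aj; rewrite xr => /(_ ij').
  by apply: (adj_notin fi flagPhi (adj_sym (conj nei ai))).
apply: phi_eq; rewrite ?groupM // !phi_imageM //.
transitivity X.
  exact: (adj_uniq jn fi (flag_phi iG fj) fX (adj_phi iG (conj nej aj)) aXi).
exact: (adj_uniq iln fj fX (flag_phi jG fi) aXj (adj_phi jG (conj nei ai))).
Qed.

(** The j-neighbour of the image of [Phi] under [g] is its image under [g * refl j], so a path of
    flags spells a word in the reflections. Faces common to both ends stay on the path and restrict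
    the ranks that occur. *)
Lemma flag_reach (K : {group gT}) C : K \subset G -> flag C ->
  (forall j D E, (j < n)%N -> flag D -> flag E -> Phi `&` C `<=` D -> Phi `&` C `<=` E ->
    adjacent rk j D E -> refl j \in K) ->
  exists2 g, g \in K & C = phi g @` Phi.
Proof.
move=> /fintype.subsetP KG fC Kj.
have [k [c [c0 ck cf cadj]]] := strongly_flag_connected poly flagPhi fC.
suff : forall i, (i <= k)%N -> exists2 g, g \in K & c i = phi g @` Phi.
  by move/(_ k (leqnn k)); rewrite ck.
elim=> [|i IH] ik; first by exists 1%g; rewrite ?group1 // phi_image1.
have [g gK cg] := IH (ltnW ik); have gG := KG g gK.
have [fi si] := cf i (ltnW ik); have [fi1 si1] := cf i.+1 ik.
have [j jn aj] := cadj i ik; have [rG ar] := reflP jn.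
have rK := Kj j _ _ jn fi fi1 si si1 aj.
exists (g * refl j)%g; first by rewrite groupM.
apply: (adj_uniq jn fi fi1 _ aj); first by apply: flag_phi; rewrite ?groupM.
by rewrite cg phi_imageM //; apply: adj_phi.
Qed.

Lemma refl_sub (A : {set gT}) : A \subset string_gens refl n -> <<A>>%g \subset G.
Proof.
move=> sA; rewrite gen_subG; apply: fintype.subset_trans sA _.
by apply/fintype.subsetP=> _ /imsetP[[j jn] _ ->]; case: (reflP jn).
Qed.

Lemma refl_gen : <<string_gens refl n>>%g = G.
Proof.
apply/eqP; rewrite finset.eqEsubset refl_sub //=; apply/fintype.subsetP=> g gG.
have sG := refl_sub (subxx (string_gens refl n)).
have [j D E jn _ _ _ _ _|h hK e] := @flag_reach <<string_gens refl n>>%G _ sG (flag_phi gG flagPhi).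
  by apply/mem_gen/mem_string_gens.
by rewrite (phi_eq gG (fintype.subsetP sG h hK) e).
Qed.

Lemma para_sub m : <<para_gens refl n m>>%g \subset G.
Proof. by apply: refl_sub; apply/fintype.subsetP=> _ /imsetP[j _ ->]; apply: mem_string_gens. Qed.

Definition fixer x : {set gT} := [set g in G | phi g x == x]%SET.

Lemma fixer_group_set x : group_set (fixer x).
Proof.
apply/group_setP; split=> [|g h]; rewrite !inE ?group1 ?phi1 ?eqxx //.
by move=> /andP[gG /eqP gx] /andP[hG /eqP hx]; rewrite groupM // phiME // hx gx eqxx.
Qed.
Canonical fixer_group x := group (fixer_group_set x).

Lemma refl_fix j m : (j < n)%N -> (m <= n.+1)%N -> (phi (refl j) (face m) == face m) = (j.+1 != m).
Proof.
move=> jn mn; have [rG aj] := reflP jn; have [Pf fr] := faceP mn.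
have fPsi := flag_phi rG flagPhi.
have in_im : phi (refl j) (face m) = face m <-> (phi (refl j) @` Phi) (face m).
  split=> [<-|[y Py e]]; first by exists (face m).
  by rewrite -{2}e -(@face_uniq m y) // -fr -e rk_phi.
apply/eqP/idP => [/in_im|jm].
  move=> Pm; apply/eqP=> jm; apply: (adj_notin flagPhi fPsi aj Pf) Pm.
  by rewrite fr -jm; lia.
apply/in_im; apply/(aj.2) => //; rewrite fr; move/eqP: jm; lia.
Qed.

(** If [g] fixes the face, a path from [Phi] to its image keeps that face by strong connectivity, so
    it never uses the reflection of rank m - 1. *)
Lemma stab_face g m : (m <= n.+1)%N -> g \in G ->
  (phi g (face m) = face m) <-> (g \in <<para_gens refl n m>>%g).
Proof.
move=> mn gG; split=> [gf|].
  have [Pf fr] := faceP mn.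
  have Cf : (Phi `&` (phi g @` Phi)) (face m) by split=> //; exists (face m).
  have [j D E jn fD fE sD sE aj|h hK e] :=
    @flag_reach <<para_gens refl n m>>%G _ (para_sub m) (flag_phi gG flagPhi).
    apply/mem_gen/mem_para_gens => //; apply/eqP => jm.
    by apply: (adj_notin fD fE aj (sD _ Cf) _ (sE _ Cf)); rewrite fr -jm; lia.
  by rewrite (phi_eq gG (fintype.subsetP (para_sub m) h hK) e).
have sub : <<para_gens refl n m>>%g \subset fixer (face m).
  rewrite gen_subG; apply/fintype.subsetP=> _ /imsetP[[j jn] jm ->].
  by rewrite inE in jm; rewrite inE refl_fix // jm; case: (reflP jn) => ->.
by move/(fintype.subsetP sub); rewrite inE => /andP[_ /eqP].
Qed.

Lemma refl_indep j : (j < n)%N -> refl j \notin <<para_gens refl n j.+1>>%g.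
Proof.
move=> jn; have [rG _] := reflP jn; apply/negP => /(stab_face _ rG)-/(_ (leqW jn))/eqP.
by rewrite (refl_fix jn (leqW jn)) eqxx.
Qed.

Lemma face_le m m' : (m <= m')%N -> (m' <= n.+1)%N -> face m <= face m'.
Proof.
move=> mm mn; have [Pm rm] := faceP (leq_trans mm mn); have [Pm' rm'] := faceP mn.
by apply: (flag_le flagPhi) => //; lia.
Qed.

Lemma flag_pair x y : x <= y -> exists g m m', [/\ g \in G, (m <= m' <= n.+1)%N,
  x = phi g (face m) & y = phi g (face m')].
Proof.
move=> xy; have [C [fC Cx Cy]] := flag_ex_le xy.
have [j D E jn _ _ _ _ _|g gK Cg] := @flag_reach G _ (subxx G) fC.
  by case: (reflP jn).
have main z : C z -> z = phi g (face (absz (rk z + 1)%R)).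
  rewrite Cg => -[t Pt <-]; rewrite rk_phi //; congr phi.
  have := rank_bounds poly t; move=> rt; apply: face_uniq => //; lia.
exists g, (absz (rk x + 1)%R), (absz (rk y + 1)%R).
split=> //; [|exact: main|exact: main].
by have := rk_le xy; have := rank_bounds poly x; have := rank_bounds poly y; lia.
Qed.

(** * Recovering the simplex from the group *)

Section Simplex.
Variable f : {morphism G >-> {perm 'I_n.+1}}.
Hypothesis f_isom : isom G [set: {perm 'I_n.+1}]%SET f.
Hypothesis f_refl : forall i, (i < n)%N -> f (refl i) = adj_tperm n i.

Definition std_face m : {set 'I_n.+1} := [set i : 'I_n.+1 | (i < m)%N]%SET.

Lemma f_para m : (f @* <<para_gens refl n m>> = <<para_gens (adj_tperm n) n m>>)%g.
Proof.
have sG : para_gens refl n m \subset G by apply: fintype.subset_trans (sub_gen _) (para_sub m).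
rewrite morphim_gen // morphimEsub //; congr <<_>>%g.
by rewrite /para_gens -imset_comp; apply: eq_imset => i /=; rewrite f_refl.
Qed.

Lemma f_std k m : k \in <<para_gens refl n m>>%g -> f k @: std_face m = std_face m.
Proof.
move=> kK; have kG := fintype.subsetP (para_sub m) k kK.
have /adj_tperm_stabP st : f k \in <<para_gens (adj_tperm n) n m>>%g.
  by rewrite -f_para mem_morphim.
apply/eqP; rewrite eqEcard (card_imset _ (@perm_inj _ _)) leqnn andbT.
by apply/fintype.subsetP=> _ /imsetP[x xm ->]; rewrite !inE in xm *; rewrite st.
Qed.

Lemma imset_fM g h (A : {set 'I_n.+1}) : g \in G -> h \in G ->
  f (g * h)%g @: A = f h @: (f g @: A).
Proof.
by move=> gG hG; rewrite -imset_comp morphM //; apply: eq_imset => x; rewrite permM.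
Qed.

Lemma card_std m : (m <= n.+1)%N -> #|std_face m| = m.
Proof.
move=> mn; rewrite -[RHS]card_ord -[RHS]sum1_card (big_ord_widen _ (fun=> 1%N) mn) -sum1_card.
by apply: eq_bigl => i; rewrite inE.
Qed.

(** Forwards, a flag through both faces factors [k^-1] into stabilisers of [face m] and [face m'].
    Backwards, a permutation taking the moved set to [std_face m] inside [std_face m'] comes from
    some [v] fixing [face m'] and agreeing with [k] on [face m], which reduces the claim to
    [face_le]. *)
Lemma phi_le_std k m m' : k \in G -> (m <= n.+1)%N -> (m' <= n.+1)%N ->
  (phi k (face m) <= face m') = (f k^-1%g @: std_face m \subset std_face m').
Proof.
move=> kG mn mn'; apply/idP/idP => [le_km|sub].
  have [u [i [i' [uG /andP[ii in1] ei ei']]]] := flag_pair le_km.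
  have rm : i = m.
    by have := congr1 rk ei; rewrite !rk_phi // !(faceP _).2 //; lia.
  have rm' : i' = m'.
    by have := congr1 rk ei'; rewrite rk_phi // !(faceP _).2 //; lia.
  subst i i'.
  have st_u : (u^-1)%g \in <<para_gens refl n m'>>%g.
    by rewrite groupV; apply/stab_face.
  have st_ku : (k^-1 * u)%g \in <<para_gens refl n m>>%g.
    by apply/stab_face; rewrite ?groupM ?groupV // phiME ?groupV // -ei phiK.
  have -> : (k^-1 = (k^-1 * u) * u^-1)%g by rewrite mulgK.
  rewrite imset_fM ?groupM ?groupV // (f_std st_ku) -[std_face m'](f_std st_u).
  apply: imsetS; apply/fintype.subsetP => x; rewrite !inE => xm; exact: leq_trans xm ii.
have cm : (m <= m')%N.
  by have := subset_leq_card sub; rewrite (card_imset _ (@perm_inj _ _)) !card_std.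
have ss : std_face m \subset std_face m'.
  by apply/fintype.subsetP => x; rewrite !inE => xm; exact: leq_trans xm cm.
have [|t [t1 t2]] := perm_subset sub ss; first by rewrite (card_imset _ (@perm_inj _ _)).
have [v vK vt] : exists2 v, v \in <<para_gens refl n m'>>%g & f v = t.
  have : t \in (f @* <<para_gens refl n m'>>)%g.
    rewrite f_para; apply: adj_tperm_stab => x.
    have := mem_imset (std_face m') x (@perm_inj _ t); rewrite t2 !inE => ->.
    by [].
  by case/morphimP=> v _ vK ->; exists v.
have vG := fintype.subsetP (para_sub m') v vK.
have kvG : (k^-1 * v)%g \in G by rewrite groupM ?groupV.
have kvK : (k^-1 * v)%g \in <<para_gens refl n m>>%g.
  have e : f (k^-1 * v)%g @: std_face m = std_face m by rewrite imset_fM ?groupV // vt.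
  have : f (k^-1 * v)%g \in (f @* <<para_gens refl n m>>)%g.
    rewrite f_para; apply: adj_tperm_stab => x.
    by have := mem_imset (std_face m) x (@perm_inj _ (f (k^-1 * v)%g)); rewrite e !inE => ->.
  case/morphimP=> w wG wK ew; suff -> : (k^-1 * v)%g = w by [].
  by have /isomP[/injmP inj _] := f_isom; apply: inj.
have e1 : phi (k^-1 * v)%g (face m) = face m := (stab_face mn kvG).2 kvK.
have e2 : phi v (face m') = face m' := (stab_face mn' vG).2 vK.
rewrite -e2 -[in leLHS]e1 -phiME ?groupM ?groupV // mulKVg phi_le //.
exact: face_le.
Qed.

(* The vertex set of the face phi g (face m); phi composes on the left whereas
   permutations act on the right, hence the inverse. *)
Definition vertices_spec x (A : {set 'I_n.+1}) :=
  exists g m, [/\ g \in G, (m <= n.+1)%N, x = phi g (face m) & A = f g^-1%g @: std_face m].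

Lemma vertices_ex x : exists A, vertices_spec x A.
Proof.
have [g [m [m' [gG /andP[mm mn] ex _]]]] := flag_pair (lexx x).
by exists (f g^-1%g @: std_face m), g, m; split=> //; apply: leq_trans mn.
Qed.

(** For x = y it also shows that the vertex set does not depend on the chosen [g] and [m]. *)
Lemma vertices_le x y A B : vertices_spec x A -> vertices_spec y B ->
  (x <= y) = (A \subset B).
Proof.
move=> [g [m [gG mn -> ->]]] [h [m' [hG mn' -> ->]]].
have hgG : (h^-1 * g)%g \in G by rewrite groupM ?groupV.
have -> : (phi g (face m) <= phi h (face m')) = (phi (h^-1 * g)%g (face m) <= face m').
  by rewrite -(phi_le _ (face m') hG) -phiME // mulKVg.
rewrite phi_le_std // invMg invgK imset_fM ?groupV //.
have fK u (X : {set 'I_n.+1}) : u \in G -> f u^-1%g @: (f u @: X) = X.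
  move=> uG; rewrite -imset_fM ?groupV // mulgV morph1 -[RHS]imset_id.
  by apply: eq_imset => z; rewrite perm1.
apply/idP/idP => [/(imsetS (f h^-1%g))|/(imsetS (f h))]; first by rewrite fK.
by have := fK h^-1%g (std_face m'); rewrite invgK groupV => ->.
Qed.

Theorem order_isomorphic_simplex : order_isomorphic P (simplex n).
Proof.
have /choice[v vP] := vertices_ex.
have v_mono : {mono v : x y / (x <= y) >-> (x \subset y)}.
  by move=> x y; rewrite -(vertices_le (vP x) (vP y)).
have v_inj : injective v.
  by move=> x y e; apply: le_anti; rewrite -!v_mono e fintype.subxx.
have v_surj A : exists x, v x = A.
  have cA : (#|A| <= n.+1)%N by rewrite -[leqRHS]card_ord max_card.
  have [|t [tA _]] := perm_subset (finset.subsetT (std_face #|A|)) (finset.subsetT A).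
    by rewrite card_std.
  have /isomP[_ fG] := f_isom.
  have : (t^-1)%g \in (f @* G)%g by rewrite fG finset.inE.
  case/morphimP=> g gG _ eg; exists (phi g (face #|A|)).
  have sp : vertices_spec (phi g (face #|A|)) A.
    by exists g, #|A|; split=> //; rewrite morphV // -eg invgK tA.
  apply/eqP; rewrite finset.eqEsubset.
  by rewrite -(vertices_le sp (vP _)) -(vertices_le (vP _) sp) lexx.
have [w wP] := choice v_surj.
exists v; split; first by exists w => [x|A]; [apply: v_inj|]; rewrite wP.
by move=> x y; rewrite -v_mono.
Qed.

End Simplex.
End AutGroup.

End Polytope.

(** * The classification for polytopes and for string C-groups *)

Unset Implicit Arguments.

Theorem theorem4p8 (p k : nat) (F : finFieldType) (n : nat) :
  prime p -> (0 < k)%N -> #|F| = (p ^ k)%N -> (4 <= n)%N ->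
  (forall (disp : Order.disp_t) (P : tbPOrderType disp) (rk : P -> int),
     abstract_polytope n rk -> regular P -> aut_group_isog P (PGL2 F) ->
     [/\ n = 4, (p ^ k)%N = 5 & order_isomorphic P (simplex 4)])
  /\
  (forall (gT : finGroupType) (G : {group gT}) (rho : 'I_n -> gT),
     string_C_group G rho -> G \isog PGL2 F ->
     [/\ n = 4, (p ^ k)%N = 5
       & exists f : {morphism G >-> {perm 'I_5}},
           isom G [set: {perm 'I_5}] f
           /\ forall i : 'I_n,
                f (rho i) = tperm (inord i : 'I_5) (inord i.+1 : 'I_5)]).
Proof.
move=> _ _ <- n4; split=> [disp P rk poly reg [phi [phi_bij phiM]]|gT G rho sC isoG].
  (* The empty chain extends to a flag, which serves as base flag. *)
  have [C fC _] := @chain_extend _ P (fun=> False) (fun _ _ (h : False) _ => match h with end).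
  have rI : indep_string (refl rk (PGL2 F) phi C) n.
    split.
    - have := refl_order poly reg phi_bij phiM fC; exact.
    - have := refl_comm poly reg phi_bij phiM fC; exact.
    - have := refl_indep poly reg phi_bij phiM fC; exact.
  have gen := refl_gen poly reg phi_bij phiM fC.
  have [en q5 [f [f_isom fE]]] := string_PGL n4 (isog_refl _) rI gen.
  split=> //; move: f f_isom fE; subst n => f f_isom fE.
  exact: (order_isomorphic_simplex poly reg phi_bij phiM fC f_isom fE).
pose r i := if insub i is Some o then rho o else 1%g.
have rE (i : 'I_n) : r i = rho i by rewrite /r valK.
have genE : <<string_gens r n>>%g = G.
  by rewrite -(sC_gen sC); congr <<_>>%g; apply: eq_imset.
have rI : indep_string r n.
  split=> [i li|i j ij jn|i li].
  - by rewrite (rE (Ordinal li)) (sC_involution sC).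
  - have li : (i < n)%N by lia.
    rewrite (rE (Ordinal li)) (rE (Ordinal jn)); apply: sqr_commute; rewrite ?(sC_involution sC) //.
    by apply: (sC_string sC); rewrite /= ij.
  pose o := Ordinal li; rewrite (rE o); apply/negP => ro.
  (* The two index sets are disjoint, so the intersection property leaves only 1. *)
  have : rho o \in <<rho @: [set o]>>%g :&: <<rho @: [set~ o]>>%g.
    rewrite inE mem_gen ?imset_f ?set11 //=.
    apply: (subsetP (genS _) _ ro); apply/subsetP => _ /imsetP[j ji ->].
    by rewrite rE imset_f // !inE -(inj_eq val_inj); move: ji; rewrite inE eqSS.
  rewrite (sC_intersection sC) setICr imset0 gen0 => /set1P r1.
  by have := sC_involution sC o; rewrite r1 order1.
have [en q5 [f [f_isom fE]]] := string_PGL n4 isoG rI genE.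
split=> //; move: f f_isom fE; subst n => f f_isom fE.
by exists f; split=> // i; rewrite -rE fE.
Qed.
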